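(* Let $K$ be a field and $n\ge1$. The following pairs are torsion pairs on $\mathcal{E}_n$, they are mutually different, and every torsion pair on $\mathcal{E}_n$ is one of them: (1) $(\mathrm{Coray}(\Delta)\oplus\mathcal{T}',\ \mathcal{F}')$, where $\emptyset\neq\Delta\subseteq(\tilde{A}_n)_0$ and $(\mathcal{T}',\mathcal{F}')$ is a torsion pair on $\tilde{A}_n((\tilde{A}_n)_0-\Delta)\text{-mod}$ which is induced by a cotilting module; (2) $(\mathcal{T}',\ \mathcal{F}'\oplus\mathrm{Ray}(\Delta))$, where $\emptyset\ne\Delta\subseteq(\tilde{A}_n)_0$ and $(\mathcal{T}',\mathcal{F}')$ is a torsion pair on $\tilde{A}_n((\tilde{A}_n)_0-\Delta)\text{-mod}$ which is induced by a tilting module.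
   Context: $\tilde{A}_n$ is the cyclic quiver with vertex set $(\tilde{A}_n)_0=\{v_1,\dots,v_n\}$ and arrows $v_1\to v_2\to\dots\to v_n\to v_1$; $J$ is the ideal of $K\tilde A_n$ generated by all arrows. $\mathcal{E}_n$ is the category of finite-dimensional $K\tilde{A}_n$-modules $M$ with $J^NM=0$ for some $N$. $S_i$ is the simple module at $v_i$. For $\Omega\subseteq(\tilde{A}_n)_0$, $\tilde{A}_n(\Omega)$ is the full subquiver on $\Omega$, and $\tilde{A}_n(\Omega)\text{-mod}$ is the category of finite-dimensional modules over its path algebra (the zero category if $\Omega=\emptyset$), viewed inside $\mathcal{E}_n$ by extension by zero. $\mathrm{Ray}(\Delta)$ is the full subcategory of $\mathcal{E}_n$ of modules whose socle lies in $\mathrm{add}\bigoplus_{v_i\in\Delta}S_i$; $\mathrm{Coray}(\Delta)$ is the full subcategory of modules whose top lies in $\mathrm{add}\bigoplus_{v_i\in\Delta}S_i$. For full subcategories $\mathcal{A},\mathcal{B}$, $\mathcal{A}\oplus\mathcal{B}$ is the full subcategory of modules isomorphic to $A\oplus B$ with $A\in\mathcal{A},B\in\mathcal{B}$. A torsion pair on an extension-closed full subcategory $\mathcal{C}$ is a pair $(\mathcal{T},\mathcal{F})$ of full (isomorphism-closed) subcategories of $\mathcal{C}$ with $\mathrm{Hom}(X,Y)=0$ for $X\in\mathcal{T},Y\in\mathcal{F}$ and such that every $X\in\mathcal{C}$ has an exact sequence $0\to X_{\mathcal{T}}\to X\to X_{\mathcal{F}}\to0$ with $X_{\mathcal{T}}\in\mathcal{T},X_{\mathcal{F}}\in\mathcal{F}$.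 A torsion pair $(\mathcal T',\mathcal F')$ on a module category is induced by a tilting module $T$ if $\mathcal{T}'=\mathrm{Gen}(T)$ (so $\mathcal{F}'=T^\bot=\{N\mid\mathrm{Hom}(T,N)=0\}$), and by a cotilting module $U$ if $\mathcal{F}'=\mathrm{Cogen}(U)$ (so $\mathcal{T}'={}^\bot U=\{M\mid\mathrm{Hom}(M,U)=0\}$); over the zero algebra the zero module is regarded as tilting and cotilting. *)

(* Defs.v *)
From HB Require Import structures.
From mathcomp Require Import all_boot all_algebra.
Set Implicit Arguments.
Unset Strict Implicit.
Unset Printing Implicit Defensive.
Import GRing.Theory.
Local Open Scope ring_scope.

(* The vertices v_1, ..., v_n of the cyclic quiver are the elements of 'I_n;
   its n arrows are also indexed by 'I_n, the arrow i going from i to ordS i.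

   The path algebra K A~_n is generated by the trivial paths e_i and the arrows
   a_i, subject to e_i e_j = delta_ij e_i, sum_i e_i = 1, a_i e_i = a_i and
   e_(ordS i) a_i = a_i (paths compose like functions).  A finite-dimensional
   module is thus a finite-dimensional space [mspace] with operators [idem i]
   and [arrow i] satisfying these relations; the space at the vertex v_i of the
   corresponding quiver representation is the image of [idem i]. *)
Record cycmod (K : fieldType) (n : nat) := CycMod {
  mspace : vectType K;
  idem : 'I_n -> 'End(mspace);
  arrow : 'I_n -> 'End(mspace);
  idem_idem : forall i j x,
    idem i (idem j x) = if i == j then idem j x else 0;
  sum_idem : forall x, \sum_(i < n) idem i x = x;
  arrow_idem : forall i x, arrow i (idem i x) = arrow i x;
  idem_arrow : forall i x, idem (ordS i) (arrow i x) = arrow i x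
}.

(* Full isomorphism-closed subcategories are given by their objects; they are
   compared extensionally. *)
Definition subcat (K : fieldType) (n : nat) := cycmod K n -> Prop.

Definition same_subcat (K : fieldType) n (A B : subcat K n) : Prop :=
  forall M, A M <-> B M.

Section Morphisms.
Variables (K : fieldType) (n : nat).
Implicit Types M N X Y Z : cycmod K n.

Definition is_hom M N (f : 'Hom(mspace M, mspace N)) : Prop :=
  (forall i x, f (idem M i x) = idem N i (f x)) /\
  (forall i x, f (arrow M i x) = arrow N i (f x)).

Definition is_mono M N (f : 'Hom(mspace M, mspace N)) : Prop :=
  is_hom f /\ lker f = 0%VS.

Definition is_epi M N (f : 'Hom(mspace M, mspace N)) : Prop :=
  is_hom f /\ limg f = fullv.

Definition isomorphic M N : Prop :=
  exists f : 'Hom(mspace M, mspace N), is_hom f /\ bijective f.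

Definition hom_zero M N : Prop :=
  forall f : 'Hom(mspace M, mspace N), is_hom f -> f = 0.

(* 0 -> X -f-> Y -g-> Z -> 0 *)
Definition short_exact X Y Z (f : 'Hom(mspace X, mspace Y))
    (g : 'Hom(mspace Y, mspace Z)) : Prop :=
  [/\ is_mono f, is_epi g & limg f = lker g].

End Morphisms.

Lemma linfun_linE (K : fieldType) (V W : vectType K) (f : V -> W)
  (f_lin : linear f) : linfun f =1 f.
Proof.
pose lf := GRing.isLinear.Build K V W *:%R f f_lin.
pose g : {linear V -> W} := HB.pack f lf.
exact: (lfunE g).
Qed.

Section DirectSum.
Variables (K : fieldType) (n : nat).

Definition pairlf (V W : vectType K) (f : 'End(V)) (g : 'End(W))
  : 'End((V * W)%type) := linfun (fun u : V * W => (f u.1, g u.2)).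

Lemma pairlfE (V W : vectType K) (f : 'End(V)) (g : 'End(W)) u :
  pairlf f g u = (f u.1, g u.2).
Proof.
apply: (@linfun_linE K (V * W)%type (V * W)%type) => a x y /=.
by rewrite !linearP.
Qed.

Section Dsum.
Variables M N : cycmod K n.
Let D : vectType K := (mspace M * mspace N)%type.
Definition dsum_idem (i : 'I_n) : 'End(D) := pairlf (idem M i) (idem N i).
Definition dsum_arrow (i : 'I_n) : 'End(D) := pairlf (arrow M i) (arrow N i).

Fact dsum_idem_idem i j x :
  dsum_idem i (dsum_idem j x) = if i == j then dsum_idem j x else 0.
Proof. by rewrite !pairlfE /= !idem_idem; case: eqP. Qed.

Fact dsum_sum_idem x : \sum_(i < n) dsum_idem i x = x.
Proof.
case: x => x y; rewrite -[in RHS](sum_idem x) -[in RHS](sum_idem y).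
under eq_bigr do rewrite pairlfE /=.
by elim/big_rec3: _ => [//|i a b c _ ->].
Qed.

Fact dsum_arrow_idem i x : dsum_arrow i (dsum_idem i x) = dsum_arrow i x.
Proof. by rewrite !pairlfE /= !arrow_idem. Qed.

Fact dsum_idem_arrow i x : dsum_idem (ordS i) (dsum_arrow i x) = dsum_arrow i x.
Proof. by rewrite !pairlfE /= !idem_arrow. Qed.

Definition dsum : cycmod K n :=
  CycMod dsum_idem_idem dsum_sum_idem dsum_arrow_idem dsum_idem_arrow.
End Dsum.

Section Zero.
Let Z : vectType K := 'rV[K]_0.
Let z : 'I_n -> 'End(Z) := fun=> 0.
Fact zero_idem_idem i j x : z i (z j x) = if i == j then z j x else 0.
Proof. by apply/rowP; case. Qed.
Fact zero_sum_idem x : \sum_(i < n) z i x = x.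
Proof. by apply/rowP; case. Qed.
Fact zero_arrow_idem i x : z i (z i x) = z i x.
Proof. by apply/rowP; case. Qed.
Fact zero_idem_arrow i x : z (ordS i) (z i x) = z i x.
Proof. by apply/rowP; case. Qed.
Definition zeromod : cycmod K n :=
  CycMod zero_idem_idem zero_sum_idem zero_arrow_idem zero_idem_arrow.
End Zero.

Definition bigdsum (s : seq (cycmod K n)) : cycmod K n := foldr dsum zeromod s.

Definition power (m : nat) (M : cycmod K n) : cycmod K n := bigdsum (nseq m M).

Definition in_add (X : cycmod K n) : subcat K n := fun Y =>
  exists (m : nat) (Z : cycmod K n), isomorphic (dsum Y Z) (power m X).

Definition Gen (X : cycmod K n) : subcat K n := fun Y =>
  exists (m : nat) (g : 'Hom(mspace (power m X), mspace Y)), is_epi g.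

Definition Cogen (X : cycmod K n) : subcat K n := fun Y =>
  exists (m : nat) (g : 'Hom(mspace Y, mspace (power m X))), is_mono g.

Definition oplus (A B : subcat K n) : subcat K n := fun M =>
  exists X Y : cycmod K n, [/\ A X, B Y & isomorphic M (dsum X Y)].

End DirectSum.

Section Simple.
Variables (K : fieldType) (n : nat) (k : 'I_n).
Let S : vectType K := K^o.
Definition simple_idem (i : 'I_n) : 'End(S) := if i == k then \1%VF else 0.
Definition simple_arrow (i : 'I_n) : 'End(S) := 0.

Fact simple_idem_idem i j x :
  simple_idem i (simple_idem j x) = if i == j then simple_idem j x else 0.
Proof.
rewrite /simple_idem; case: (eqVneq i j) => [->|ij].
  by case: eqP => _; rewrite ?id_lfunE // !zero_lfunE.
case: (eqVneq i k) => [ik|_]; last by rewrite zero_lfunE.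
by rewrite -ik eq_sym (negPf ij) zero_lfunE linear0.
Qed.

Fact simple_sum_idem x : \sum_(i < n) simple_idem i x = x.
Proof.
rewrite (bigD1 k) //= big1 ?addr0 /simple_idem ?eqxx ?id_lfunE //.
by move=> i /negPf ->; rewrite zero_lfunE.
Qed.

Fact simple_arrow_idem i x : simple_arrow i (simple_idem i x) = simple_arrow i x.
Proof. by rewrite !zero_lfunE. Qed.

Fact simple_idem_arrow i x :
  simple_idem (ordS i) (simple_arrow i x) = simple_arrow i x.
Proof. by rewrite !zero_lfunE linear0. Qed.

Definition simple_at : cycmod K n :=
  CycMod simple_idem_idem simple_sum_idem simple_arrow_idem simple_idem_arrow.
End Simple.

Section Tube.
Variables (K : fieldType) (n : nat).
Implicit Types (M : cycmod K n) (Delta : {set 'I_n}).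

(* J^N is spanned by the products of at least N arrows. *)
Definition Ecat : subcat K n := fun M =>
  exists N : nat, forall (s : seq 'I_n) (x : mspace M),
    size s = N -> foldr (fun i => arrow M i) x s = 0.

Definition submodule M (U : {vspace mspace M}) : Prop :=
  forall i : 'I_n, (idem M i @: U <= U)%VS /\ (arrow M i @: U <= U)%VS.

Definition simple_submodule M (U : {vspace mspace M}) : Prop :=
  [/\ submodule U, U <> 0%VS &
      forall W : {vspace mspace M},
        submodule W -> (W <= U)%VS -> W = 0%VS \/ W = U].

Definition maximal_submodule M (U : {vspace mspace M}) : Prop :=
  [/\ submodule U, U <> fullv &
      forall W : {vspace mspace M},
        submodule W -> (U <= W)%VS -> W = U \/ W = fullv].

(* U is the sum of all simple submodules of M *)
Definition is_socle M (U : {vspace mspace M}) : Prop :=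
  (forall W, simple_submodule W -> (W <= U)%VS) /\
  (forall U', (forall W, simple_submodule W -> (W <= U')%VS) -> (U <= U')%VS).

(* U is the intersection of all maximal submodules of M *)
Definition is_radical M (U : {vspace mspace M}) : Prop :=
  (forall W, maximal_submodule W -> (U <= W)%VS) /\
  (forall U', (forall W, maximal_submodule W -> (U' <= W)%VS) -> (U' <= U)%VS).

Definition simples_sum Delta : cycmod K n :=
  bigdsum [seq simple_at K k | k <- enum Delta].

Definition Ray Delta : subcat K n := fun M =>
  Ecat M /\
  exists (S : cycmod K n) (f : 'Hom(mspace S, mspace M)),
    [/\ is_mono f, is_socle (limg f) & in_add (simples_sum Delta) S].

Definition Coray Delta : subcat K n := fun M =>
  Ecat M /\
  exists (S : cycmod K n) (g : 'Hom(mspace M, mspace S)),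
    [/\ is_epi g, is_radical (lker g) & in_add (simples_sum Delta) S].

Definition torsion_pair (C T F : subcat K n) : Prop :=
  [/\ (forall X, T X -> C X) /\ (forall X, F X -> C X),
      (forall X Y, isomorphic X Y -> T X -> T Y) /\
      (forall X Y, isomorphic X Y -> F X -> F Y),
      forall X Y, T X -> F Y -> hom_zero X Y &
      forall X, C X ->
        exists (XT XF : cycmod K n) (f : 'Hom(mspace XT, mspace X))
               (g : 'Hom(mspace X, mspace XF)),
          [/\ T XT, F XF & short_exact f g]].

End Tube.

(* The full subquiver on Omega has the arrows i with i and ordS i in Omega, and
   its path algebra is the quotient of K A~_n by the e_i with i not in Omega.
   Hence, extended by zero, its finite-dimensional modules are the K A~_n-modules
   killed by these e_i. *)
Definition Omega_mod (K : fieldType) n (Omega : {set 'I_n}) : subcat K n :=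
  fun M => forall i, i \notin Omega -> idem M i = 0.

(* (i, l) is the path of length l starting at i, all of whose vertices lie in
   Omega.  When Omega is a proper subset of the vertices, all paths of the full
   subquiver have length < n, so that these are all its paths. *)
Definition path_in n (Omega : {set 'I_n}) (p : 'I_n * 'I_n) : bool :=
  [forall m : 'I_n, (m <= p.2)%N ==> (iter m (@ordS n) p.1 \in Omega)].

Definition qpath n (Omega : {set 'I_n}) : finType :=
  {p : 'I_n * 'I_n | path_in Omega p}.

Section Paths.
Variables (n : nat) (Omega : {set 'I_n}).
Implicit Types p q : qpath Omega.

Definition psrc p : 'I_n := (val p).1.
Definition plen p : nat := (val p).2.
Definition ptgt p : 'I_n := iter (plen p) (@ordS n) (psrc p).

(* q = a_j p *)
Definition arrow_path (j : 'I_n) p q : bool :=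
  [&& ptgt p == j, psrc q == psrc p & plen q == (plen p).+1].

(* q = p a_j *)
Definition path_arrow p (j : 'I_n) q : bool :=
  [&& psrc p == ordS j, psrc q == j & plen q == (plen p).+1].

End Paths.

(* The function f stands for sum_p f(p) p. *)
Section Regular.
Variables (K : fieldType) (n : nat) (Omega : {set 'I_n}).
Let P := qpath Omega.
Let L : vectType K := {ffun P -> K^o}.

Definition reg_idem (j : 'I_n) : 'End(L) :=
  linfun (fun f : L => [ffun q : P => if ptgt q == j then f q else 0] : L).

Definition reg_arrow (j : 'I_n) : 'End(L) :=
  linfun (fun f : L => [ffun q : P => \sum_(p | arrow_path j p q) f p] : L).

Lemma reg_idemE j f q : reg_idem j f q = if ptgt q == j then f q else 0.
Proof.
rewrite /reg_idem linfun_linE ?ffunE // => a x y.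
by apply/ffunP => p; rewrite !ffunE; case: ifP; rewrite ?scaler0 ?addr0.
Qed.

Lemma reg_arrowE j f q : reg_arrow j f q = \sum_(p | arrow_path j p q) f p.
Proof.
rewrite /reg_arrow linfun_linE ?ffunE // => a x y.
apply/ffunP => p; rewrite !ffunE scaler_sumr -big_split /=.
by apply: eq_bigr => r _; rewrite !ffunE.
Qed.

Fact reg_idem_idem i j f :
  reg_idem i (reg_idem j f) = if i == j then reg_idem j f else 0.
Proof.
apply/ffunP => q; rewrite !reg_idemE; case: (eqVneq i j) => [->|ij].
  by rewrite reg_idemE; case: (ptgt q == j).
case: (eqVneq (ptgt q) i) => [->|_]; last by rewrite ffunE.
by rewrite (negPf ij) ffunE.
Qed.

Fact reg_sum_idem f : \sum_(i < n) reg_idem i f = f.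
Proof.
apply/ffunP => q; rewrite sum_ffunE (bigD1 (ptgt q)) //= big1.
  by rewrite addr0 reg_idemE eqxx.
by move=> i ne; rewrite reg_idemE eq_sym (negPf ne).
Qed.

Fact reg_arrow_idem i f : reg_arrow i (reg_idem i f) = reg_arrow i f.
Proof.
apply/ffunP => q; rewrite !reg_arrowE; apply: eq_bigr => p.
by case/and3P => /eqP pi _ _; rewrite reg_idemE pi eqxx.
Qed.

Fact reg_idem_arrow i f : reg_idem (ordS i) (reg_arrow i f) = reg_arrow i f.
Proof.
apply/ffunP => q; rewrite reg_idemE reg_arrowE; case: ifPn => // qi.
rewrite big1 // => p /and3P[/eqP pi /eqP qs /eqP ql].
by case/eqP: qi; rewrite -pi /ptgt ql qs.
Qed.

Definition regular : cycmod K n :=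
  CycMod reg_idem_idem reg_sum_idem reg_arrow_idem reg_idem_arrow.

(* On the K-dual of the regular right module, (a f)(p) = f(p a). *)
Definition dreg_idem (j : 'I_n) : 'End(L) :=
  linfun (fun f : L => [ffun p : P => if psrc p == j then f p else 0] : L).

Definition dreg_arrow (j : 'I_n) : 'End(L) :=
  linfun (fun f : L => [ffun p : P => \sum_(q | path_arrow p j q) f q] : L).

Lemma dreg_idemE j f p : dreg_idem j f p = if psrc p == j then f p else 0.
Proof.
rewrite /dreg_idem linfun_linE ?ffunE // => a x y.
by apply/ffunP => q; rewrite !ffunE; case: ifP; rewrite ?scaler0 ?addr0.
Qed.

Lemma dreg_arrowE j f p : dreg_arrow j f p = \sum_(q | path_arrow p j q) f q.
Proof.
rewrite /dreg_arrow linfun_linE ?ffunE // => a x y.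
apply/ffunP => q; rewrite !ffunE scaler_sumr -big_split /=.
by apply: eq_bigr => r _; rewrite !ffunE.
Qed.

Fact dreg_idem_idem i j f :
  dreg_idem i (dreg_idem j f) = if i == j then dreg_idem j f else 0.
Proof.
apply/ffunP => q; rewrite !dreg_idemE; case: (eqVneq i j) => [->|ij].
  by rewrite dreg_idemE; case: (psrc q == j).
case: (eqVneq (psrc q) i) => [->|_]; last by rewrite ffunE.
by rewrite (negPf ij) ffunE.
Qed.

Fact dreg_sum_idem f : \sum_(i < n) dreg_idem i f = f.
Proof.
apply/ffunP => q; rewrite sum_ffunE (bigD1 (psrc q)) //= big1.
  by rewrite addr0 dreg_idemE eqxx.
by move=> i ne; rewrite dreg_idemE eq_sym (negPf ne).
Qed.

Fact dreg_arrow_idem i f : dreg_arrow i (dreg_idem i f) = dreg_arrow i f.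
Proof.
apply/ffunP => p; rewrite !dreg_arrowE; apply: eq_bigr => q.
by case/and3P => _ /eqP qi _; rewrite dreg_idemE qi eqxx.
Qed.

Fact dreg_idem_arrow i f : dreg_idem (ordS i) (dreg_arrow i f) = dreg_arrow i f.
Proof.
apply/ffunP => p; rewrite dreg_idemE dreg_arrowE; case: ifPn => // pi.
by rewrite big1 // => q /and3P[/eqP pi' _ _]; case/eqP: pi.
Qed.

Definition dual_regular : cycmod K n :=
  CycMod dreg_idem_idem dreg_sum_idem dreg_arrow_idem dreg_idem_arrow.

End Regular.

Section Tilting.
Variables (K : fieldType) (n : nat).
Implicit Types (C : subcat K n) (P X Y Z I : cycmod K n).

Definition projective_in C P : Prop :=
  C P /\
  forall X Y (g : 'Hom(mspace X, mspace Y)) (h : 'Hom(mspace P, mspace Y)),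
    C X -> C Y -> is_epi g -> is_hom h ->
    exists h' : 'Hom(mspace P, mspace X), is_hom h' /\ (g \o h')%VF = h.

Definition injective_in C I : Prop :=
  C I /\
  forall X Y (f : 'Hom(mspace X, mspace Y)) (h : 'Hom(mspace X, mspace I)),
    C X -> C Y -> is_mono f -> is_hom h ->
    exists h' : 'Hom(mspace Y, mspace I), is_hom h' /\ (h' \o f)%VF = h.

Definition pd_le1 C X : Prop :=
  exists (P1 P0 : cycmod K n) (f : 'Hom(mspace P1, mspace P0))
         (g : 'Hom(mspace P0, mspace X)),
    [/\ projective_in C P1, projective_in C P0 & short_exact f g].

Definition id_le1 C X : Prop :=
  exists (I0 I1 : cycmod K n) (f : 'Hom(mspace X, mspace I0))
         (g : 'Hom(mspace I0, mspace I1)),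
    [/\ injective_in C I0, injective_in C I1 & short_exact f g].

(* Ext^1(X, Y) = 0 in C: every extension of X by Y in C splits. *)
Definition ext1_zero C X Y : Prop :=
  forall (E : cycmod K n) (f : 'Hom(mspace Y, mspace E))
         (g : 'Hom(mspace E, mspace X)),
    C E -> short_exact f g ->
    exists s : 'Hom(mspace X, mspace E), is_hom s /\ (g \o s)%VF = \1%VF.

(* Tilting and cotilting modules over the path algebra of the full subquiver on
   Omega, for Omega a proper subset of the vertices (see [path_in]).  For the
   zero algebra (Omega empty) exactly the zero modules qualify. *)
Definition tilting (Omega : {set 'I_n}) (T : cycmod K n) : Prop :=
  let C := Omega_mod (K := K) Omega in
  [/\ C T, pd_le1 C T, ext1_zero C T T &
      exists (T0 T1 : cycmod K n)
             (f : 'Hom(mspace (regular K Omega), mspace T0))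
             (g : 'Hom(mspace T0, mspace T1)),
        [/\ in_add T T0, in_add T T1 & short_exact f g]].

Definition cotilting (Omega : {set 'I_n}) (U : cycmod K n) : Prop :=
  let C := Omega_mod (K := K) Omega in
  [/\ C U, id_le1 C U, ext1_zero C U U &
      exists (U1 U0 : cycmod K n)
             (f : 'Hom(mspace U1, mspace U0))
             (g : 'Hom(mspace U0, mspace (dual_regular K Omega))),
        [/\ in_add U U0, in_add U U1 & short_exact f g]].

(* Since (T, F) is a torsion pair, either of T and F determines the other, so it
   suffices to compare F with Cogen U, respectively T with Gen X. *)
Definition cotilting_datum (Delta : {set 'I_n}) (T F : subcat K n) : Prop :=
  [/\ Delta != set0, torsion_pair (Omega_mod (~: Delta)) T F &
      exists U, cotilting (~: Delta) U /\ same_subcat F (Cogen U)].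

Definition tilting_datum (Delta : {set 'I_n}) (T F : subcat K n) : Prop :=
  [/\ Delta != set0, torsion_pair (Omega_mod (~: Delta)) T F &
      exists X, tilting (~: Delta) X /\ same_subcat T (Gen X)].

End Tilting.

(* Main.v *)
(* A torsion pair (T, F) on E_n is governed by supports.  If T and F both had full
   support, the halves of the torsion sequence of a long uniserial module would
   give a nonzero map from T to F; so F (or, dually, T) lives on a proper vertex
   set Omega, the complement of Delta.  If F has support exactly Omega, then T
   restricted to Omega vanishes at the last vertex of each component of Omega;
   this forces the extensions of T' by Coray(Delta) to split, so that the torsion
   class of F in E_n is Coray(Delta) + T'.  It remains to see that the torsion-free
   classes on Omega with full support are exactly those cogenerated by a cotilting
   module: if F0 -> I is a right F-approximation of least dimension of an injective
   cogenerator I, with kernel F1, then F0 + F1 is cotilting by Wakamatsu's lemma.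
   Case (2) follows from case (1) by vector space duality, which reverses the
   quiver. *)
From HB Require Import structures.
Require Import Defs.
From mathcomp Require Import all_boot all_algebra.
From Stdlib Require Import Classical.
Set Implicit Arguments.
Unset Strict Implicit.
Unset Printing Implicit Defensive.
Import GRing.Theory.
Local Open Scope ring_scope.

(** * Linear algebra and modules over the cyclic quiver *)

(** Indecomposables are never classified and no module is decomposed completely; two devices replace
    the combinatorics of uniserial modules. [path_hom] turns a functional on M and an element of N
    into a map through a uniserial module. Cutting at the longest path on which the functional
    survives makes it a homomorphism, and both contradictions with Hom(T, F) = 0 arise from such
    maps. [complement_ex] finds complements by maximality, provided the arrows act on the submodule
    surjectively where this matters, or all act by zero; semisimplicity, injectivity and the
    splitting of extensions by corays are instances of it. The vanishing of T at the last vertices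
    is used twice: for that splitting, and to see that the projective generator is torsion-free,
    which makes the approximation of an injective surjective. Subcategories are mere predicates on
    modules, so minimal and maximal objects are found by extremal dimensions, with classical
    logic. *)

Lemma ex_least (P : nat -> Prop) :
  (exists k, P k) -> exists k, P k /\ forall m, P m -> (k <= m)%N.
Proof.
move=> [k0 Pk0]; apply: NNPP => no.
suff H k : forall m, (m <= k)%N -> ~ P m by exact: (H k0 k0).
elim: k => [|k IH] m.
  rewrite leqn0 => /eqP -> P0; apply: no; exists 0%N; split=> // j _.
rewrite leq_eqVlt ltnS => /orP[/eqP -> Pk|]; last exact: IH.
apply: no; exists k.+1; split=> // j Pj; rewrite leqNgt; apply/negP.
by rewrite ltnS => /IH.
Qed.

Lemma ex_greatest (P : nat -> Prop) (b : nat) :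
  (exists k, P k) -> (forall k, P k -> (k <= b)%N) ->
  exists k, P k /\ forall m, P m -> (m <= k)%N.
Proof.
move=> [k0 Pk0] ub; have [|k [Pk kmin]] := @ex_least (fun j => (j <= b)%N /\ P (b - j)%N).
  by exists (b - k0)%N; rewrite leq_subr subKn ?ub.
exists (b - k)%N; split; first by case: Pk.
move=> m Pm; have mb := ub _ Pm.
have /kmin : ((b - m <= b)%N /\ P (b - (b - m))%N) by rewrite leq_subr subKn.
by move=> km; rewrite leq_subRL ?(proj1 Pk) // addnC -leq_subRL.
Qed.

Section LinearAlgebra.
Variable K : fieldType.
Implicit Types V W : vectType K.

Lemma functional_nonzero V (v : V) : v != 0 ->
  exists phi : 'Hom(V, K^o), phi v = 1.
Proof.
move=> v0; have [i ci] : exists i, coord (vbasis {:V}) i v != 0.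
  apply: NNPP => no; case/eqP: v0; rewrite (coord_vbasis (memvf v)).
  apply: big1 => i _; have [->|ci] := eqVneq (coord (vbasis {:V}) i v) 0.
    by rewrite scale0r.
  by case: no; exists i.
exists ((coord (vbasis {:V}) i v)^-1 *: linfun (coord (vbasis {:V}) i : V -> K^o)).
by rewrite scale_lfunE lfunE; apply: mulVf.
Qed.

Lemma functional_sep V (U : {vspace V}) (v : V) : v \notin U ->
  exists phi : 'Hom(V, K^o), phi v = 1 /\ forall u, u \in U -> phi u = 0.
Proof.
move=> vU; have v0 : v - projv U v != 0.
  by apply: contra vU; rewrite subr_eq0 => /eqP ->; exact: memv_proj.
have [phi phiv] := functional_nonzero v0.
exists (phi \o (\1 - projv U))%VF; split=> [|u uU].
  by rewrite comp_lfunE add_lfunE opp_lfunE id_lfunE.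
by rewrite comp_lfunE add_lfunE opp_lfunE id_lfunE projv_id // subrr linear0.
Qed.

Lemma lker0_inj V W (f : 'Hom(V, W)) : lker f = 0%VS -> injective f.
Proof. by move=> f0; apply/lker0P; rewrite f0. Qed.

Lemma lker0_intro V W (f : 'Hom(V, W)) : (forall x, f x = 0 -> x = 0) -> lker f = 0%VS.
Proof.
move=> H; apply/eqP; rewrite -subv0; apply/subvP => x.
by rewrite memv_ker memv0 => /eqP /H ->.
Qed.

Lemma limg_full V W (f : 'Hom(V, W)) : limg f = fullv -> forall y, exists x, f x = y.
Proof.
by move=> ff y; have := memvf y; rewrite -ff => /memv_imgP[x _ ->]; exists x.
Qed.

Lemma limg_full_intro V W (f : 'Hom(V, W)) :
  (forall y, exists x, f x = y) -> limg f = fullv.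
Proof.
move=> H; apply/vspaceP => y; rewrite memvf; have [x <-] := H y.
by rewrite memv_img ?memvf.
Qed.

Lemma fullvP V (U : {vspace V}) : (forall x, x \in U) -> U = fullv.
Proof. by move=> H; apply/vspaceP => x; rewrite memvf H. Qed.

Lemma limgP V W (f : 'Hom(V, W)) y : y \in limg f -> exists x, y = f x.
Proof. by move=> /memv_imgP[x _ ->]; exists x. Qed.

Lemma mem_limg V W (f : 'Hom(V, W)) x : f x \in limg f.
Proof. by rewrite memv_img ?memvf. Qed.

Lemma lker_bij_dim V W (f : 'Hom(V, W)) : lker f = 0%VS ->
  (\dim {:W} <= \dim {:V})%N -> limg f = fullv.
Proof.
move=> f0 d; apply/eqP; rewrite eqEdim subvf /= limg_dim_eq //.
by rewrite f0 capv0.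
Qed.

Lemma not_sub_compl V (U : {vspace V}) : U <> fullv -> exists x, x \notin U.
Proof.
by move=> nU; apply: NNPP => no; apply: nU; apply: fullvP => x; apply/negPn/negP => h; apply: no; exists x.
Qed.

End LinearAlgebra.

(** * Paths around the cycle, homomorphisms, submodules, quotients and direct sums *)

Section Cyclic.
Variables (K : fieldType) (n : nat).
Implicit Types (M N X Y Z : cycmod K n) (i j c : 'I_n).

Definition sh k c : 'I_n := iter k (@ordS n) c.

Arguments sh : simpl never.

Lemma shS k c : sh k.+1 c = ordS (sh k c). Proof. by []. Qed.
Lemma shSr k c : sh k.+1 c = sh k (ordS c). Proof. exact: iterSr. Qed.
Lemma sh_val k c : val (sh k c) = ((c + k) %% n)%N.
Proof.
elim: k => [|k IH]; first by rewrite addn0 modn_small.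
by rewrite shS /= IH -addn1 modnDml addn1 addnS.
Qed.
Lemma sh_surj k j : exists c, sh k c = j.
Proof.
elim: k => [|k [c <-]]; first by exists j.
by exists (ord_pred c); rewrite shSr ord_predK.
Qed.
Lemma sh_eq k c : (sh k c == c) = (n %| k)%N.
Proof.
apply/eqP/idP => [e|/dvdnP[q ->]]; last first.
  by by apply: val_inj; rewrite sh_val addnC modnMDl modn_small.
have : (c + k = c + 0 %[mod n])%N by rewrite -sh_val e addn0 modn_small.
by move/eqP; rewrite eqn_modDl mod0n.
Qed.
Lemma sh_to c d : exists2 k, (k < n)%N & sh k c = d.
Proof.
have n0 : (0 < n)%N by case: (n) c => [[]|].
exists ((d + (n - c)) %% n)%N; first by rewrite ltn_mod.
apply: val_inj; rewrite sh_val modnDmr addnCA subnKC ?(ltnW (ltn_ord c)) //.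
by rewrite modnDr modn_small.
Qed.

(** All arrows at once: on the space at i it acts as [arrow M i], so the path of length k from c
    acts as [pw M k] on the space at c. Hence J^k M is the image of [pw M k], and compatibility with
    all arrows becomes a single equation. *)
Definition tot M : 'End(mspace M) := \sum_i arrow M i.

Definition pw M k : 'End(mspace M) := iter k (fun f => (tot M \o f)%VF) \1%VF.

Arguments pw : simpl never.

Lemma tot_idem M i x : tot M (idem M i x) = arrow M i x.
Proof.
rewrite sum_lfunE (bigD1 i) //= arrow_idem big1 ?addr0 // => j ji.
by rewrite -arrow_idem idem_idem (negPf ji) linear0.
Qed.

Lemma idem_tot M i x : idem M (ordS i) (tot M x) = tot M (idem M i x).
Proof.
rewrite tot_idem sum_lfunE linear_sum (bigD1 i) //= idem_arrow big1 ?addr0 // => j ji.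
rewrite -idem_arrow idem_idem; case: eqP => // /ordS_inj ij.
by rewrite ij eqxx in ji.
Qed.

Lemma pw0 M x : pw M 0 x = x. Proof. exact: id_lfunE. Qed.
Lemma pwS M k x : pw M k.+1 x = tot M (pw M k x). Proof. exact: comp_lfunE. Qed.
Lemma pwD M k l x : pw M (k + l) x = pw M k (pw M l x).
Proof. by elim: k => [|k IH]; rewrite ?pw0 // addSn !pwS IH. Qed.
Lemma pw1 M x : pw M 1 x = tot M x. Proof. by rewrite pwS pw0. Qed.
Lemma pwSr M k x : pw M k.+1 x = pw M k (tot M x).
Proof. by rewrite -addn1 pwD pw1. Qed.

Lemma pw_idem M k i x : pw M k (idem M i x) = idem M (sh k i) (pw M k x).
Proof. by elim: k x => [|k IH] x; rewrite ?pw0 // !pwS IH shS idem_tot. Qed.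

Lemma idemK M i x : idem M i (idem M i x) = idem M i x.
Proof. by rewrite idem_idem eqxx. Qed.

Lemma pw_hid M k i x : idem M i x = x -> idem M (sh k i) (pw M k x) = pw M k x.
Proof. by move=> h; rewrite -pw_idem h. Qed.

Lemma idem_hid M i j x : idem M i x = x -> idem M j x = if j == i then x else 0.
Proof. by move=> h; rewrite -{1}h idem_idem h. Qed.

Lemma nonzero_idem M x : x != 0 -> exists i, idem M i x != 0.
Proof.
move=> x0; apply: NNPP => no; case/eqP: x0; rewrite -(sum_idem x).
by apply: big1 => i _; apply/eqP/negPn/negP => h; apply: no; exists i.
Qed.

Lemma notin_idem M (U : {vspace mspace M}) x : x \notin U -> exists i, idem M i x \notin U.
Proof.
move=> xU; apply: NNPP => no; case/negP: xU; rewrite -(sum_idem x).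
by apply: memv_suml => i _; apply/negPn/negP => h; apply: no; exists i.
Qed.

Section FromTot.
Variables (V : vectType K) (e : 'I_n -> 'End(V)) (A : 'End(V)).
Hypothesis ee : forall i j x, e i (e j x) = if i == j then e j x else 0.
Hypothesis se : forall x, \sum_i e i x = x.
Hypothesis eA : forall i x, e (ordS i) (A x) = A (e i x).

Definition tcyc_arrow i : 'End(V) := (A \o e i)%VF.
Fact tcyc_arrow_idem i x : tcyc_arrow i (e i x) = tcyc_arrow i x.
Proof. by rewrite !comp_lfunE ee eqxx. Qed.
Fact tcyc_idem_arrow i x : e (ordS i) (tcyc_arrow i x) = tcyc_arrow i x.
Proof. by rewrite !comp_lfunE eA ee eqxx. Qed.
(** Idempotents and one operator shifting them by one vertex suffice to define a module. Submodules,
    quotients, duals and uniserial modules are built this way. *)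
Definition tcyc : cycmod K n := CycMod ee se tcyc_arrow_idem tcyc_idem_arrow.
Lemma tot_tcyc x : tot tcyc x = A x.
Proof.
rewrite sum_lfunE -[in RHS](se x) linear_sum; apply: eq_bigr => i _.
by rewrite comp_lfunE.
Qed.
End FromTot.

Record hom M N := Hom {
  hfun :> 'Hom(mspace M, mspace N);
  homP : is_hom hfun
}.

Lemma hom_idem M N (f : hom M N) i x : f (idem M i x) = idem N i (f x).
Proof. by case: (homP f) => + _; apply. Qed.
Lemma hom_tot M N (f : hom M N) x : f (tot M x) = tot N (f x).
Proof.
rewrite !sum_lfunE linear_sum; apply: eq_bigr => i _.
by case: (homP f) => _; apply.
Qed.
Lemma hom_pw M N (f : hom M N) k x : f (pw M k x) = pw N k (f x).
Proof. by elim: k => [|k IH]; rewrite ?pw0 // !pwS hom_tot IH. Qed.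
Lemma hom_ker0 M N (f : hom M N) : (forall x, f x = 0 -> x = 0) -> lker f = 0%VS.
Proof. exact: lker0_intro. Qed.

Lemma is_hom_tot M N (f : 'Hom(mspace M, mspace N)) :
  (forall i x, f (idem M i x) = idem N i (f x)) ->
  (forall x, f (tot M x) = tot N (f x)) -> is_hom f.
Proof. by move=> fe fA; split=> // i x; rewrite -!tot_idem fA fe. Qed.

Lemma hom_ex M N (f : mspace M -> mspace N) : linear f ->
  (forall i x, f (idem M i x) = idem N i (f x)) ->
  (forall x, f (tot M x) = tot N (f x)) -> {h : hom M N | h =1 f}.
Proof.
move=> lf fe fA; have h1 := linfun_linE lf.
suff P : is_hom (linfun f : 'Hom(mspace M, mspace N)) by exists (Hom P).
by apply: is_hom_tot => *; rewrite !h1.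
Qed.

Lemma is_hom_id M : is_hom (\1%VF : 'Hom(mspace M, mspace M)).
Proof. by split=> i x; rewrite !id_lfunE. Qed.
Definition hid M : hom M M := Hom (is_hom_id M).
Lemma hidE M x : hid M x = x. Proof. exact: id_lfunE. Qed.

Lemma is_hom_comp M N X (g : hom N X) (f : hom M N) : is_hom (g \o f)%VF.
Proof. by apply: is_hom_tot => *; rewrite !comp_lfunE ?hom_idem ?hom_tot. Qed.
Definition hcomp M N X (g : hom N X) (f : hom M N) : hom M X := Hom (is_hom_comp g f).
Lemma hcompE M N X (g : hom N X) (f : hom M N) x : hcomp g f x = g (f x).
Proof. exact: comp_lfunE. Qed.

Lemma is_hom_add M N (f g : hom M N) : is_hom (hfun f + hfun g).
Proof. by apply: is_hom_tot => *; rewrite !add_lfunE linearD ?hom_idem ?hom_tot. Qed.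
Definition hadd M N (f g : hom M N) : hom M N := Hom (is_hom_add f g).
Lemma haddE M N (f g : hom M N) x : hadd f g x = f x + g x.
Proof. exact: add_lfunE. Qed.

Lemma is_hom_opp M N (f : hom M N) : is_hom (- hfun f).
Proof. by apply: is_hom_tot => *; rewrite !opp_lfunE ?linearN ?hom_idem ?hom_tot. Qed.
Definition hopp M N (f : hom M N) : hom M N := Hom (is_hom_opp f).
Lemma hoppE M N (f : hom M N) x : hopp f x = - f x.
Proof. exact: opp_lfunE. Qed.

Lemma is_hom_zero M N : is_hom (0 : 'Hom(mspace M, mspace N)).
Proof. by split=> i x; rewrite !zero_lfunE linear0. Qed.
Definition hzero M N : hom M N := Hom (is_hom_zero M N).
Lemma hzeroE M N x : hzero M N x = 0.
Proof. exact: zero_lfunE. Qed.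

Lemma submoduleP M (U : {vspace mspace M}) :
  submodule U <-> (forall i x, x \in U -> idem M i x \in U) /\
                  (forall x, x \in U -> tot M x \in U).
Proof.
split=> [H|[He HA] i].
  split=> [i x xU|x xU].
    by have [/subvP h _] := H i; apply: h; rewrite memv_img.
  rewrite sum_lfunE; apply: memv_suml => i _.
  by have [_ /subvP h] := H i; apply: h; rewrite memv_img.
split; apply/subvP => _ /memv_imgP[x xU ->]; first exact: He.
by rewrite -tot_idem; apply: HA; apply: He.
Qed.

Lemma submodule_limg M N (f : hom M N) : submodule (limg f).
Proof.
by apply/submoduleP; split=> [i|] _ /limgP[x ->]; rewrite -?hom_idem -?hom_tot mem_limg.
Qed.

Lemma submodule_lker M N (f : hom M N) : submodule (lker f).
Proof.
by apply/submoduleP; split=> [i|] x; rewrite !memv_ker ?hom_idem ?hom_tot => /eqP ->; rewrite linear0.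
Qed.

Lemma submodule_pw M (U : {vspace mspace M}) k x : submodule U -> x \in U -> pw M k x \in U.
Proof.
by move=> /submoduleP[_ h] xU; elim: k => [|k IH]; rewrite ?pw0 // pwS h.
Qed.

Lemma submodule_cap M (U W : {vspace mspace M}) :
  submodule U -> submodule W -> submodule (U :&: W)%VS.
Proof.
move=> /submoduleP[Ue UA] /submoduleP[We WA]; apply/submoduleP.
by split=> [i|] x; rewrite !memv_cap => /andP[? ?]; rewrite ?Ue ?We ?UA ?WA.
Qed.

Lemma submodule_add M (U W : {vspace mspace M}) :
  submodule U -> submodule W -> submodule (U + W)%VS.
Proof.
move=> /submoduleP[Ue UA] /submoduleP[We WA]; apply/submoduleP.
by split=> [i|] _ /memv_addP[u uU [w wW ->]]; rewrite linearD memv_add ?Ue ?We ?UA ?WA.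
Qed.

Lemma submodule0 M : submodule (0%VS : {vspace mspace M}).
Proof.
by apply/submoduleP; split=> [i|] x; rewrite !memv0 => /eqP ->; rewrite linear0.
Qed.

Lemma sub_ex M (U : {vspace mspace M}) : submodule U ->
  exists (S : cycmod K n) (f : hom S M), lker f = 0%VS /\ limg f = U.
Proof.
move=> /submoduleP[Ue UA].
pose inc : 'Hom(subvs_of U, mspace M) := linfun vsval.
pose prj : 'Hom(mspace M, subvs_of U) := linfun (vsproj U).
have incE x : inc x = vsval x by rewrite lfunE.
have incK x : prj (inc x) = x by rewrite !lfunE /= vsvalK.
have prjK x : x \in U -> inc (prj x) = x by move=> xU; rewrite !lfunE /= vsprojK.
have incU x : inc x \in U by rewrite incE subvsP.
pose e i := (prj \o idem M i \o inc)%VF; pose A := (prj \o tot M \o inc)%VF.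
have incI : injective inc := can_inj incK.
have ie i x : inc (e i x) = idem M i (inc x) by rewrite !comp_lfunE prjK ?Ue.
have iA x : inc (A x) = tot M (inc x) by rewrite !comp_lfunE prjK ?UA.
have ee i j x : e i (e j x) = if i == j then e j x else 0.
  by apply: incI; rewrite !ie idem_idem; case: eqP; rewrite ?linear0 ?ie.
have se x : \sum_i e i x = x.
  by apply: incI; rewrite linear_sum -[RHS](sum_idem (c := M)); apply: eq_bigr => i _; exact: ie.
have eA i x : e (ordS i) (A x) = A (e i x).
  by apply: incI; rewrite ie !iA ie idem_tot.
have [|||f fE] := @hom_ex (tcyc ee se eA) M inc.
- by move=> a x y; rewrite linearP.
- by move=> i x; rewrite ie.
- by move=> x; rewrite tot_tcyc iA.
exists (tcyc ee se eA), f; split.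
  by apply: lker0_intro => x; rewrite fE => h; apply: incI; rewrite h linear0.
apply/vspaceP => y; apply/idP/idP => [/limgP[x ->]|yU]; first by rewrite fE.
by rewrite -(prjK y yU) -fE mem_limg.
Qed.

(** The quotient lives on the vector space complement [U^C]; its operators are those of M followed
    by the projection along U. *)
Lemma quot_ex M (U : {vspace mspace M}) : submodule U ->
  exists (Q : cycmod K n) (g : hom M Q), limg g = fullv /\ lker g = U.
Proof.
move=> /submoduleP[Ue UA].
pose inc : 'Hom(subvs_of U^C, mspace M) := linfun vsval.
have [prj pE] : exists prj : 'Hom(mspace M, subvs_of U^C),
    forall x, inc (prj x) = x - projv U x.
  exists (linfun (vsproj U^C) \o (\1 - projv U))%VF => x.
  by rewrite comp_lfunE add_lfunE opp_lfunE id_lfunE !lfunE /= vsprojK ?memv_projC.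
have incI : injective inc by move=> x y; rewrite !lfunE; exact: subvs_inj.
have kp x : (prj x == 0) = (x \in U).
  apply/eqP/idP => [h|xU].
    have := pE x; rewrite h linear0 => /esym/eqP; rewrite subr_eq0 => /eqP ->.
    exact: memv_proj.
  by apply: incI; rewrite pE projv_id // subrr linear0.
have iK x : prj (inc x) = x.
  apply: incI; rewrite pE; suff -> : projv U (inc x) = 0 by rewrite subr0.
  by apply/eqP; rewrite -memv_ker lker_proj lfunE subvsP.
have eqp x y : x - y \in U -> prj x = prj y.
  by rewrite -kp linearB subr_eq0 => /eqP.
have mi x : inc (prj x) - x \in U.
  by rewrite pE addrC addKr memvN memv_proj.
pose e i := (prj \o idem M i \o inc)%VF; pose A := (prj \o tot M \o inc)%VF.
have ie i x : e i (prj x) = prj (idem M i x).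
  by rewrite !comp_lfunE; apply: eqp; rewrite -linearB Ue ?mi.
have iA x : A (prj x) = prj (tot M x).
  by rewrite !comp_lfunE; apply: eqp; rewrite -linearB UA ?mi.
have ee i j x : e i (e j x) = if i == j then e j x else 0.
  by rewrite -(iK x) !ie idem_idem; case: eqP; rewrite ?linear0.
have se x : \sum_i e i x = x.
  by rewrite -(iK x) -[in RHS](sum_idem (inc x)) linear_sum; apply: eq_bigr => i _; rewrite ie.
have eA i x : e (ordS i) (A x) = A (e i x).
  by rewrite -(iK x) ie !iA ie idem_tot.
have [|||g gE] := @hom_ex M (tcyc ee se eA) prj.
- by move=> a x y; rewrite linearP.
- by move=> i x; rewrite -ie.
- by move=> x; rewrite tot_tcyc iA.
exists (tcyc ee se eA), g; split; first by apply: limg_full_intro => y; exists (inc y); rewrite gE iK.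
by apply/vspaceP => x; rewrite memv_ker gE kp.
Qed.

Lemma factor_mono S M X (f : hom S M) (h : hom X M) : lker f = 0%VS ->
  (forall x, h x \in limg f) -> exists h' : hom X S, forall x, f (h' x) = h x.
Proof.
move=> f0 hf; have fI := lker0_inj f0.
have E x : f ((f^-1 \o h)%VF x) = h x by rewrite comp_lfunE limg_lfunVK.
suff P : is_hom (f^-1 \o h)%VF by exists (Hom P).
by apply: is_hom_tot => *; apply: fI; rewrite ?hom_idem ?hom_tot !E ?hom_idem ?hom_tot.
Qed.

Lemma factor_epi M Q Y (g : hom M Q) (h : hom M Y) : limg g = fullv ->
  (forall x, g x = 0 -> h x = 0) -> exists h' : hom Q Y, forall x, h' (g x) = h x.
Proof.
move=> gf gh.
have gK x : g (g^-1%VF x) = x by rewrite limg_lfunVK // gf memvf.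
have E x : (h \o g^-1)%VF (g x) = h x.
  rewrite comp_lfunE; apply/eqP; rewrite -subr_eq0 -linearB; apply/eqP/gh.
  by rewrite linearB /= gK subrr.
suff P : is_hom (h \o g^-1)%VF by exists (Hom P).
by apply: is_hom_tot => [i|] x; rewrite -(gK x) -?hom_idem -?hom_tot !E ?hom_idem ?hom_tot.
Qed.

Lemma iso_intro M N (f : hom M N) : lker f = 0%VS -> limg f = fullv -> isomorphic M N.
Proof.
move=> f0 ff; exists f; split; first exact: homP.
exists (f^-1)%VF => x; first by rewrite lker0_lfunK ?f0.
by rewrite limg_lfunVK // ff memvf.
Qed.

Lemma iso_elim M N : isomorphic M N ->
  exists (f : hom M N) (g : hom N M), cancel f g /\ cancel g f.
Proof.
move=> [f0 [Hf [g fg gf]]]; have [f fE] : exists f : hom M N, hfun f = f0 by exists (Hom Hf).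
rewrite -fE in fg gf => {f0 fE Hf}.
have lg : linear g.
  by move=> a x y; apply: (can_inj fg); rewrite linearP /= !gf.
have [||G GE] := @hom_ex N M g lg.
- by move=> i x; apply: (can_inj fg); rewrite hom_idem !gf.
- by move=> x; apply: (can_inj fg); rewrite hom_tot !gf.
by exists f, G; split=> x; rewrite GE ?fg ?gf.
Qed.

Lemma iso_of_cancel M N (f : hom M N) (g : hom N M) : cancel f g -> cancel g f -> isomorphic M N.
Proof. by move=> fg gf; exists f; split; [exact: homP|exists g]. Qed.

Lemma iso_refl M : isomorphic M M.
Proof. by apply: (@iso_of_cancel _ _ (hid M) (hid M)) => x; rewrite !hidE. Qed.
Lemma iso_sym M N : isomorphic M N -> isomorphic N M.
Proof. by move=> /iso_elim[f [g [fg gf]]]; apply: iso_of_cancel gf fg. Qed.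
Lemma iso_trans M N X : isomorphic M N -> isomorphic N X -> isomorphic M X.
Proof.
move=> /iso_elim[f [g [fg gf]]] /iso_elim[f' [g' [fg' gf']]].
by apply: (@iso_of_cancel _ _ (hcomp f' f) (hcomp g g')) => x; rewrite !hcompE ?fg' ?fg ?gf ?gf'.
Qed.

Lemma pairE (V W : vectType K) (x : V * W) : x = (x.1, x.2). Proof. by case: x. Qed.

Lemma dsum_idemE M N i x : idem (dsum M N) i x = (idem M i x.1, idem N i x.2).
Proof. exact: pairlfE. Qed.

Lemma dsum_totE M N x : tot (dsum M N) x = (tot M x.1, tot N x.2).
Proof.
rewrite !sum_lfunE; under eq_bigr do rewrite /= pairlfE.
by elim/big_rec3: _ => [//|i a b c _ ->].
Qed.

Lemma dsum_pwE M N k x : pw (dsum M N) k x = (pw M k x.1, pw N k x.2).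
Proof. by elim: k => [|k IH]; rewrite ?pw0 ?pwS ?IH ?dsum_totE //; case: x. Qed.

Lemma hpair_ex X M N (f : hom X M) (g : hom X N) : {h : hom X (dsum M N) | h =1 fun x => (f x, g x)}.
Proof.
apply: hom_ex => [a x y|i x|x]; rewrite ?dsum_idemE ?dsum_totE /= ?hom_idem ?hom_tot //.
by rewrite !linearP.
Qed.
Definition hpair X M N (f : hom X M) (g : hom X N) := sval (hpair_ex f g).
Lemma hpairE X M N (f : hom X M) (g : hom X N) x : hpair f g x = (f x, g x).
Proof. exact: (svalP (hpair_ex f g)). Qed.

Lemma hcopair_ex X M N (f : hom M X) (g : hom N X) :
  {h : hom (dsum M N) X | h =1 fun x => f x.1 + g x.2}.
Proof.
apply: hom_ex => [a x y|i x|x].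
- by rewrite /= !linearP /= addrACA scalerDr.
- by rewrite dsum_idemE /= !hom_idem linearD.
- by rewrite dsum_totE /= !hom_tot linearD.
Qed.
Definition hcopair X M N (f : hom M X) (g : hom N X) := sval (hcopair_ex f g).
Lemma hcopairE X M N (f : hom M X) (g : hom N X) x : hcopair f g x = f x.1 + g x.2.
Proof. exact: (svalP (hcopair_ex f g)). Qed.

Definition hinl M N : hom M (dsum M N) := hpair (hid M) (hzero M N).
Definition hinr M N : hom N (dsum M N) := hpair (hzero N M) (hid N).
Definition hfst M N : hom (dsum M N) M := hcopair (hid M) (hzero N M).
Definition hsnd M N : hom (dsum M N) N := hcopair (hzero M N) (hid N).
Lemma hinlE M N x : hinl M N x = (x, 0). Proof. by rewrite hpairE hidE hzeroE. Qed.
Lemma hinrE M N x : hinr M N x = (0, x). Proof. by rewrite hpairE hidE hzeroE. Qed.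
Lemma hfstE M N x : hfst M N x = x.1. Proof. by rewrite hcopairE hidE hzeroE addr0. Qed.
Lemma hsndE M N x : hsnd M N x = x.2. Proof. by rewrite hcopairE hidE hzeroE add0r. Qed.

Lemma iso_dsum_sub Y (C W : {vspace mspace Y}) (S1 S2 : cycmod K n) (f1 : hom S1 Y) (f2 : hom S2 Y) :
  lker f1 = 0%VS -> limg f1 = C -> lker f2 = 0%VS -> limg f2 = W ->
  (C :&: W = 0)%VS -> (C + W)%VS = fullv -> isomorphic Y (dsum S1 S2).
Proof.
move=> k1 l1 k2 l2 cap add; apply: iso_sym; apply: (@iso_intro _ _ (hcopair f1 f2)).
  apply: lker0_intro => x; rewrite hcopairE => /eqP; rewrite addr_eq0 => /eqP E.
  have : f1 x.1 \in (C :&: W)%VS.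
    by rewrite memv_cap -{1}l1 mem_limg E memvN -l2 mem_limg.
  rewrite cap memv0 => /eqP E1; move: E; rewrite E1 => /esym/eqP; rewrite oppr_eq0 => /eqP E2.
  rewrite (pairE x); congr pair; first by apply: (lker0_inj k1); rewrite E1 linear0.
  by apply: (lker0_inj k2); rewrite E2 linear0.
apply: limg_full_intro => y; have := memvf y; rewrite -add => /memv_addP[c cC [w wW ->]].
move: cC wW; rewrite -l1 -l2 => /limgP[a ->] /limgP[b ->].
by exists (a, b); rewrite hcopairE.
Qed.

End Cyclic.
Arguments sh {n} k c : simpl never.
Arguments pw {K n} M k : simpl never.
Arguments hid {K n}. Arguments hzero {K n}.

(** * Homomorphisms supported on a path, and torsion pairs *)

Section PathHom.
Variables (K : fieldType) (n : nat) (M N : cycmod K n).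
Variables (phi : 'Hom(mspace M, K^o)) (c : 'I_n) (L : nat) (y : mspace N).
Hypothesis yc : idem N c y = y.
Hypothesis yL : pw N L.+1 y = 0.
Hypothesis phiL : forall m, phi (pw M L.+1 m) = 0.

(** This is a composite M -> V -> N, where V is uniserial of length L + 1 with top at c. The first
    map reads the coordinates of m off [phi] along paths to the end of V; the second sends the
    generator of V to y. The three hypotheses are exactly what these maps need. *)
Lemma path_hom_ex : {h : hom M N | forall m,
  h m = \sum_(k < L.+1) phi (pw M (L - k) (idem M (sh k c) m)) *: pw N k y}.
Proof.
apply: hom_ex => [a x z|i x|x].
- rewrite scaler_sumr -big_split; apply: eq_bigr => k _ /=.
  by rewrite !linearP /= scalerDl scalerA.
- rewrite linear_sum; apply: eq_bigr => k _; rewrite linearZ /=.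
  rewrite idem_idem (idem_hid i (pw_hid k yc)) (eq_sym i).
  by case: eqP => [->|_]; rewrite ?linear0 ?scale0r ?scaler0.
- rewrite linear_sum big_ord_recl [RHS]big_ord_recr /=.
  (* After the index shift two boundary terms remain: the last one vanishes by [yL], the first one
     because it is [phi] at a value of [pw M L.+1]. *)
  rewrite linearZ /= -pwS yL scaler0 addr0 subn0.
  rewrite -{1}(ord_predK c) idem_tot -pwSr phiL scale0r add0r.
  apply: eq_bigr => k _; rewrite linearZ /= -pwS /bump /= add1n; congr (phi _ *: _).
  by rewrite shS idem_tot -pwSr -subSn // subSS.
Qed.

Definition path_hom := sval path_hom_ex.

Lemma path_homE m : path_hom m =
  \sum_(k < L.+1) phi (pw M (L - k) (idem M (sh k c) m)) *: pw N k y.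
Proof. exact: (svalP path_hom_ex). Qed.

(** For m at c, a term with k > 0 can only survive if the path has returned to c, so if n divides k;
    then [pw N k y] is zero. *)
Lemma path_hom_src m : pw N n y = 0 -> idem M c m = m ->
  path_hom m = phi (pw M L m) *: y.
Proof.
move=> yn mc; rewrite path_homE big_ord_recl /= subn0 pw0 mc big1 ?addr0 // => k _.
rewrite (idem_hid _ mc); case: ifP; last by rewrite !linear0 scale0r.
rewrite sh_eq => /dvdnP[[|q]]; first by [].
by rewrite mulSn (addnC n) => ->; rewrite pwD yn linear0 scaler0.
Qed.

End PathHom.

Section Torsion.
Variables (K : fieldType) (n : nat).
Implicit Types (M N X Y Z : cycmod K n) (i j c : 'I_n) (C T F : subcat K n).

Lemma hom_zeroP X Y : hom_zero X Y <-> forall (f : hom X Y) x, f x = 0.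
Proof.
split=> [H f x|H f Hf]; first by rewrite (H f (homP f)) zero_lfunE.
by apply/lfunP => x; rewrite zero_lfunE (H (Hom Hf)).
Qed.

Lemma tp_seq C T F X : torsion_pair C T F -> C X ->
  exists (XT XF : cycmod K n) (f : hom XT X) (g : hom X XF),
    [/\ T XT, F XF, lker f = 0%VS, limg g = fullv & limg f = lker g].
Proof.
move=> [_ _ _ H] /H [XT [XF [f [g [TX FX [[Hf kf] [Hg lg] fg]]]]]].
by exists XT, XF, (Hom Hf), (Hom Hg); split.
Qed.

Lemma short_exact_intro X Y Z (f : hom X Y) (g : hom Y Z) :
  lker f = 0%VS -> limg g = fullv -> limg f = lker g -> short_exact f g.
Proof. by move=> *; split=> //; split=> //; exact: homP. Qed.

Lemma short_exact_elim X Y Z (f : 'Hom(mspace X, mspace Y)) (g : 'Hom(mspace Y, mspace Z)) :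
  short_exact f g -> exists (f' : hom X Y) (g' : hom Y Z),
   [/\ hfun f' = f, hfun g' = g, lker f' = 0%VS, limg g' = fullv & limg f' = lker g'].
Proof. by move=> [[Hf kf] [Hg lg] fg]; exists (Hom Hf), (Hom Hg). Qed.

Lemma torsionP C T F X : torsion_pair C T F ->
  T X <-> C X /\ forall Y, F Y -> hom_zero X Y.
Proof.
move=> tp; have [[TC FC] [Ti Fi] TF _] := tp; split=> [TX|[CX H]].
  by split; [exact: TC|move=> Y FY; exact: TF].
have [XT [XF [f [g [TT FF kf lg fg]]]]] := tp_seq tp CX.
apply: Ti TT; apply: (iso_intro kf).
by rewrite fg; apply: fullvP => x; rewrite memv_ker (proj1 (hom_zeroP _ _) (H _ FF)).
Qed.

Lemma torsionfreeP C T F Y : torsion_pair C T F ->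
  F Y <-> C Y /\ forall X, T X -> hom_zero X Y.
Proof.
move=> tp; have [[TC FC] [Ti Fi] TF _] := tp; split=> [FY|[CY H]].
  by split; [exact: FC|move=> X TX; exact: TF].
have [XT [XF [f [g [TT FF kf lg fg]]]]] := tp_seq tp CY.
apply: Fi FF; apply: iso_sym; apply: (iso_intro _ lg); apply: lker0_intro => y.
move/eqP; rewrite -memv_ker -fg => /limgP[x ->].
by rewrite (proj1 (hom_zeroP _ _) (H _ TT)).
Qed.

Definition sub_closed C := forall M N (f : hom M N), lker f = 0%VS -> C N -> C M.
Definition quot_closed C := forall M N (f : hom M N), limg f = fullv -> C M -> C N.

Lemma torsionfree_sub C T F M N (f : hom M N) : torsion_pair C T F -> sub_closed C ->
  lker f = 0%VS -> F N -> F M.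
Proof.
move=> tp sC kf /(torsionfreeP _ tp)[CN H]; apply/(torsionfreeP _ tp).
split=> [|X TX]; first exact: (sC _ _ f).
apply/hom_zeroP => g x; apply: (lker0_inj kf).
by have /hom_zeroP/(_ (hcomp f g) x) := H _ TX; rewrite hcompE linear0.
Qed.

Lemma torsion_quot C T F M N (f : hom M N) : torsion_pair C T F -> quot_closed C ->
  limg f = fullv -> T M -> T N.
Proof.
move=> tp sC lf /(torsionP _ tp)[CM H]; apply/(torsionP _ tp).
split=> [|Y FY]; first exact: (sC _ _ f).
apply/hom_zeroP => g x; have [z <-] := limg_full lf x.
by have /hom_zeroP/(_ (hcomp g f) z) := H _ FY; rewrite hcompE.
Qed.

Lemma torsionfree_ext C T F A E B (f : hom A E) (g : hom E B) : torsion_pair C T F ->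
  lker f = 0%VS -> limg f = lker g -> C E -> F A -> F B -> F E.
Proof.
move=> tp kf fg CE /(torsionfreeP _ tp)[CA HA] /(torsionfreeP _ tp)[CB HB].
apply/(torsionfreeP _ tp); split=> // X TX; apply/hom_zeroP => h x.
have [y|h' hE] := @factor_mono _ _ _ _ _ f h kf.
  rewrite fg memv_ker; have /hom_zeroP/(_ (hcomp g h) y) := HB _ TX.
  by rewrite hcompE => ->.
by rewrite -hE; have /hom_zeroP -> := HA _ TX; rewrite linear0.
Qed.

Lemma torsionfree_dsum C T F A B : torsion_pair C T F -> C (dsum A B) -> F A -> F B -> F (dsum A B).
Proof.
move=> tp CAB FA FB; apply: (@torsionfree_ext _ _ _ _ _ _ (hinl A B) (hsnd A B) tp) => //.
  by apply: lker0_intro => x; rewrite hinlE => -[].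
apply/vspaceP => x; rewrite memv_ker hsndE; apply/idP/eqP => [/limgP[a ->]|x2].
  by rewrite hinlE.
have -> : x = hinl A B x.1 by rewrite hinlE -x2; exact: pairE.
exact: mem_limg.
Qed.

Lemma torsion_dsum C T F A B : torsion_pair C T F -> C (dsum A B) -> T A -> T B -> T (dsum A B).
Proof.
move=> tp CAB /(torsionP _ tp)[_ HA] /(torsionP _ tp)[_ HB].
apply/(torsionP _ tp); split=> // Y FY; apply/hom_zeroP => h x.
have /hom_zeroP/(_ (hcomp h (hinl A B)) x.1) := HA _ FY.
have /hom_zeroP/(_ (hcomp h (hinr A B)) x.2) := HB _ FY.
rewrite !hcompE hinlE hinrE => h2 h1.
have -> : x = hinl A B x.1 + hinr A B x.2.
  by rewrite hinlE hinrE [LHS]pairE; congr pair; rewrite /= ?addr0 ?add0r.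
by rewrite linearD /= hinlE hinrE h1 h2 addr0.
Qed.

Lemma zero_ex : exists Z : cycmod K n, forall x : mspace Z, x = 0.
Proof. by exists (zeromod K n) => x; apply/rowP; case. Qed.

Lemma torsionfree_zero C T F Z : torsion_pair C T F -> C Z -> (forall x : mspace Z, x = 0) -> F Z.
Proof.
by move=> tp CZ z0; apply/(torsionfreeP _ tp); split=> // X TX; apply/hom_zeroP => f x; apply: z0.
Qed.

Lemma torsion_pair_same C T F C' T' F' : same_subcat C C' -> same_subcat T T' -> same_subcat F F' ->
  torsion_pair C T F -> torsion_pair C' T' F'.
Proof.
move=> cc tt ff [[TC FC] [Ti Fi] TF H]; split.
- by split=> X; [move=> /tt/TC/cc|move=> /ff/FC/cc].
- by split=> X Y XY => [/tt/(Ti _ _ XY)/tt|/ff/(Fi _ _ XY)/ff].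
- by move=> X Y /tt TX /ff; apply: TF.
- move=> X /cc/H [XT [XF [f [g [/tt ? /ff ? ?]]]]].
  by exists XT, XF, f, g; split.
Qed.

(** On the space at c the power of [tot] is the product of the arrows along the path from c;
    conversely every value of a product of arrows is a value of the corresponding power. *)
Lemma Ecat_pw M : Ecat M <-> exists k, forall x, pw M k x = 0.
Proof.
split=> -[k H]; exists k; [move=> x|move=> s x sk].
  have P c l : exists2 s, size s = l &
      pw M l (idem M c x) = foldr (fun i => arrow M i) (idem M c x) s.
    elim: l => [|l [s sl E]]; first by exists [::]; rewrite ?pw0.
    exists (sh l c :: s); rewrite /= ?sl // -E -tot_idem -pw_idem idemK pwS.
    by [].
  rewrite -(sum_idem x) linear_sum big1 // => c _ /=.
  by have [s sl ->] := P c k; apply: H.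
suff [z ->] : exists z, foldr (fun i => arrow M i) x s = pw M (size s) z.
  by rewrite sk H.
elim: s {sk} => [|i s [z IH]] /=; first by exists x; rewrite pw0.
have [c <-] := sh_surj (size s) i.
by exists (idem M c z); rewrite IH -tot_idem -pw_idem pwS.
Qed.

Lemma Ecat_sub : sub_closed (@Ecat K n).
Proof.
move=> M N f kf /Ecat_pw[k H]; apply/Ecat_pw; exists k => x.
by apply: (lker0_inj kf); rewrite hom_pw H linear0.
Qed.

Lemma pw_le M k l x : (k <= l)%N -> pw M k x = 0 -> pw M l x = 0.
Proof. by move=> kl h; rewrite -(subnK kl) pwD h linear0. Qed.

Lemma Ecat_dsum M N : Ecat M -> Ecat N -> Ecat (dsum M N).
Proof.
move=> /Ecat_pw[k Hk] /Ecat_pw[l Hl]; apply/Ecat_pw; exists (maxn k l) => x.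
by rewrite dsum_pwE (pw_le (leq_maxl k l)) ?(pw_le (leq_maxr k l)).
Qed.

Lemma Omega_idem (O : {set 'I_n}) M i x : Omega_mod O M -> i \notin O -> idem M i x = 0.
Proof. by move=> H /H ->; rewrite zero_lfunE. Qed.

Lemma Omega_intro (O : {set 'I_n}) M : (forall i x, i \notin O -> idem M i x = 0) -> Omega_mod O M.
Proof. by move=> H i iO; apply/lfunP => x; rewrite zero_lfunE H. Qed.

Lemma Omega_sub (O : {set 'I_n}) : sub_closed (@Omega_mod K n O).
Proof.
move=> M N f kf H; apply: Omega_intro => i x iO.
by apply: (lker0_inj kf); rewrite hom_idem (Omega_idem _ H) // linear0.
Qed.

Lemma Omega_quot (O : {set 'I_n}) : quot_closed (@Omega_mod K n O).
Proof.
move=> M N f lf H; apply: Omega_intro => i y iO.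
by have [x <-] := limg_full lf y; rewrite -hom_idem (Omega_idem _ H) // linear0.
Qed.

Lemma Omega_dsum (O : {set 'I_n}) M N : Omega_mod O M -> Omega_mod O N -> Omega_mod O (dsum M N).
Proof.
move=> HM HN; apply: Omega_intro => i x iO.
by rewrite dsum_idemE (Omega_idem _ HM) // (Omega_idem _ HN).
Qed.

(** From any vertex the missing vertex d is reached in fewer than n steps, and there M is zero. *)
Lemma Omega_pw (O : {set 'I_n}) d M x : d \notin O -> Omega_mod O M -> pw M n x = 0.
Proof.
move=> dO H; rewrite -(sum_idem x) linear_sum big1 // => c _ /=.
have [k kn sk] := sh_to c d.
by apply: (pw_le (ltnW kn)); rewrite pw_idem sk (Omega_idem _ H).
Qed.

Lemma Omega_Ecat (O : {set 'I_n}) d M : d \notin O -> Omega_mod O M -> Ecat M.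
Proof. by move=> dO H; apply/Ecat_pw; exists n => x; exact: Omega_pw dO H. Qed.

Lemma nilp_last M (U : {vspace mspace M}) x : Ecat M -> x \notin U ->
  exists k, pw M k x \notin U /\ tot M (pw M k x) \in U.
Proof.
move=> /Ecat_pw[l H] xU.
have [||k [Pk kmax]] := @ex_greatest (fun k => pw M k x \notin U) l.
- by exists 0%N; rewrite pw0.
- by move=> k; apply: contraR; rewrite -ltnNge => lk; rewrite (pw_le (ltnW lk)) ?mem0v.
exists k; split=> //; rewrite -pwS; apply/negPn/negP => /kmax.
by rewrite ltnn.
Qed.

(** W is a submodule of greatest dimension that contains G and meets C trivially. If W + C were
    proper, nilpotence would give an element y at one vertex, outside W + C, with [tot Y y] inside.
    The condition on C allows y to be corrected by an element of C so that its image falls into W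
    itself; then W could be enlarged by y. *)
Lemma complement_ex Y (C G : {vspace mspace Y}) : Ecat Y ->
  submodule C -> submodule G -> (G :&: C = 0)%VS ->
  ((forall x, tot Y x = 0) \/
   forall i, (forall y, idem Y i y \in C) \/
     (forall z, z \in C -> exists2 d, d \in C & tot Y (idem Y i d) = idem Y (ordS i) z)) ->
  exists W, [/\ submodule W, (G <= W)%VS, (W :&: C = 0)%VS & (W + C)%VS = fullv].
Proof.
move=> EY sC sG GC H.
pose P d := exists W : {vspace mspace Y}, [/\ submodule W, (G <= W)%VS, (W :&: C = 0)%VS & \dim W = d].
have [||d [[W [sW GW WC dW]] dmax]] := @ex_greatest P (\dim {:mspace Y}).
- by exists (\dim G), G.
- by move=> _ [W [_ _ _ <-]]; apply: dimvS; exact: subvf.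
exists W; split=> //; apply: NNPP => /not_sub_compl[x xWC].
have [We WA] := proj1 (submoduleP _) sW; have [Ce CA] := proj1 (submoduleP _) sC.
(* Maximality: if [tot Y y] were in W, then W + <y> would be a larger admissible submodule. *)
have key i y : idem Y i y = y -> y \notin (W + C)%VS -> tot Y y \notin W.
  move=> yi yWC; apply/negP => yW; have yW' : y \notin W.
    by apply: contra yWC => /(subvP (addvSl W C)).
  suff /dmax : P (\dim (W + <[y]>)).
    move: yW'; rewrite -dW => yW' h; case/negP: yW'.
    have /eqP E : W == (W + <[y]>)%VS by rewrite eqEdim addvSl h.
    by rewrite E (subvP (addvSr W <[y]>)) ?memv_line.
  exists (W + <[y]>)%VS; split=> //.
  - apply/submoduleP; split=> [j|] _ /memv_addP[w wW [_ /vlineP[a ->] ->]].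
      rewrite linearD linearZ /= (idem_hid _ yi) memv_add ?We //.
      by case: ifP; rewrite ?scaler0 ?mem0v ?memvZ ?memv_line.
    rewrite linearD linearZ /=; apply: (subvP (addvSl W _)).
    by rewrite memvD ?memvZ // WA.
  - exact: subv_trans GW (addvSl _ _).
  apply/eqP; rewrite -subv0; apply/subvP => z; rewrite memv_cap => /andP[].
  move=> /memv_addP[w wW [_ /vlineP[a ->] ->]] zC.
  have a0 : a = 0.
    apply/eqP/negPn/negP => a0; case/negP: yWC.
    have -> : y = - a^-1 *: w + a^-1 *: (w + a *: y).
      by rewrite scalerDr scalerA mulVf // scale1r scaleNr addKr.
    by rewrite memv_add ?memvZ.
  by move: zC; rewrite a0 scale0r addr0 => zC; rewrite -WC memv_cap wW.
have [i xi] := notin_idem xWC.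
have [k [kW kW']] := nilp_last EY xi.
set y := pw Y k _ in kW kW'; set j := sh k i.
have yj : idem Y j y = y by rewrite pw_hid ?idemK.
have [tot0|/(_ j)[yC|surj]] := H.
- by case/negP: (key j y yj kW); rewrite tot0 mem0v.
- by case/negP: kW; rewrite -yj (subvP (addvSr W C)).
(* With [tot Y y = w + c], subtracting the part at j of a u in C lying over c leaves the class
   modulo W + C unchanged and moves the image of y into W. *)
have /memv_addP[w wW [c cC E]] := kW'.
have [u uC uE] := surj c cC.
have y1W : y - idem Y j u \notin (W + C)%VS.
  apply: contra kW => h; rewrite -(subrK (idem Y j u) y) memvD //.
  by rewrite (subvP (addvSr W C)) ?Ce.
have y1j : idem Y j (y - idem Y j u) = y - idem Y j u by rewrite linearB /= idemK yj.
case/negP: (key j _ y1j y1W).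
rewrite linearB /= uE -yj -idem_tot E linearD /= addrK; exact: We.
Qed.

End Torsion.

(** * Rays and corays *)

Section Cogeneration.
Variables (K : fieldType) (n : nat).
Implicit Types (M N X Y Z : cycmod K n) (i j c : 'I_n).

(** A map into a power with the smallest kernel is injective, since one further factor would
    separate any nonzero element of the kernel. *)
Lemma cogen_intro X Y : (forall x, x != 0 -> exists h : hom X Y, h x != 0) ->
  exists m (g : hom X (power m Y)), lker g = 0%VS.
Proof.
move=> H; pose P d := exists m (g : hom X (power m Y)), \dim (lker g) = d.
have [|d [[m [g gd]] dmin]] := @ex_least P.
  by exists (\dim (lker (hzero X (power 0 Y)))), 0%N, (hzero X (power 0 Y)).
exists m, g; apply: NNPP => /eqP; rewrite -vpick0 => /H[h hx].
set x := vpick _ in hx.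
pose g' : hom X (power m.+1 Y) := hpair h g.
have sub : (lker g' <= lker g)%VS.
  by apply/subvP => y; rewrite !memv_ker hpairE => /eqP[_ ->].
have /dmin : P (\dim (lker g')) by exists m.+1, g'.
rewrite -gd => h'; case/negP: hx.
have /eqP E : lker g' == lker g by rewrite eqEdim sub h'.
have : x \in lker g by rewrite memv_pick.
by rewrite -E memv_ker hpairE => /eqP[-> _].
Qed.

Lemma gen_intro X Y : (forall y, exists (h : hom X Y) x, h x = y) ->
  exists m (g : hom (power m X) Y), limg g = fullv.
Proof.
move=> H; pose P d := exists m (g : hom (power m X) Y), \dim (limg g) = d.
have [||d [[m [g gd]] dmax]] := @ex_greatest P (\dim {:mspace Y}).
- by exists (\dim (limg (hzero (power 0 X) Y))), 0%N, (hzero (power 0 X) Y).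
- by move=> _ [m [g <-]]; apply: dimvS; exact: subvf.
exists m, g; apply: NNPP => /not_sub_compl[y yg].
have [h [x hx]] := H y.
pose g' : hom (power m.+1 X) Y := hcopair h g.
have sub : (limg g <= limg g')%VS.
  apply/subvP => _ /limgP[z ->].
  have -> : g z = g' (0, z) by rewrite hcopairE linear0 add0r.
  exact: mem_limg.
have /dmax : P (\dim (limg g')) by exists m.+1, g'.
rewrite -gd => h'; case/negP: yg.
have /eqP -> : limg g == limg g' by rewrite eqEdim sub h'.
have -> : y = g' (x, 0) by rewrite hcopairE linear0 addr0.
exact: mem_limg.
Qed.

Lemma subcat_power (A : subcat K n) Y m : (forall Z, (forall z : mspace Z, z = 0) -> A Z) ->
  (forall M N, A M -> A N -> A (dsum M N)) -> A Y -> A (power m Y).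
Proof.
move=> A0 AD AY; elim: m => [|m IH] /=; last exact: AD.
by apply: A0 => z; apply/rowP; case.
Qed.

Definition semisimple_on (D : {set 'I_n}) M :=
  (forall x, tot M x = 0) /\ (forall i x, i \notin D -> idem M i x = 0).

Lemma semisimple_sub D M N (f : hom M N) : lker f = 0%VS -> semisimple_on D N -> semisimple_on D M.
Proof.
move=> kf [H1 H2]; split=> [x|i x iD]; apply: (lker0_inj kf).
  by rewrite hom_tot H1 linear0.
by rewrite hom_idem H2 // linear0.
Qed.

Lemma semisimple_dsum D M N : semisimple_on D M -> semisimple_on D N -> semisimple_on D (dsum M N).
Proof.
move=> [H1 H2] [H3 H4]; split=> [x|i x iD]; first by rewrite dsum_totE H1 H3.
by rewrite dsum_idemE H2 // H4.
Qed.

Lemma semisimple_zero D Z : (forall z : mspace Z, z = 0) -> semisimple_on D Z.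
Proof. by move=> z0; split=> *; apply: z0. Qed.

Lemma tot_simple (k : 'I_n) x : tot (simple_at K k) x = 0.
Proof. by rewrite sum_lfunE big1 // => i _; rewrite zero_lfunE. Qed.

Lemma semisimple_simples D : semisimple_on D (simples_sum K D).
Proof.
rewrite /simples_sum; have : {subset enum D <= D} by move=> k; rewrite mem_enum.
elim: (enum D) => [|k s IH] ks /=; first by apply: semisimple_zero => z; apply/rowP; case.
apply: semisimple_dsum; last by apply: IH => j js; apply: ks; rewrite inE js orbT.
split=> [x|i x iD]; first exact: tot_simple.
rewrite /= /simple_idem; case: eqP => [E|_]; last by rewrite zero_lfunE.
by move: iD; rewrite E ks ?mem_head.
Qed.

Lemma simple_in_sum (k : 'I_n) (s : seq 'I_n) : k \in s ->
  exists f : hom (simple_at K k) (bigdsum [seq simple_at K j | j <- s]), lker f = 0%VS.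
Proof.
elim: s => [//|j s IH]; rewrite inE; set B := bigdsum [seq simple_at K j | j <- s] in IH *.
have [-> _|kj /IH[f kf]] := eqVneq k j.
  by exists (hinl (simple_at K j) B); apply: hom_ker0 => x; rewrite hinlE => -[].
exists (hcomp (hinr (simple_at K j) B) f); apply: hom_ker0 => x; rewrite hcompE hinrE => -[].
by move=> fx; apply: (lker0_inj kf); rewrite fx linear0.
Qed.

Lemma Ecat_tot0 M : (forall x, tot M x = 0) -> Ecat M.
Proof. by move=> H; apply/Ecat_pw; exists 1%N => x; rewrite pw1. Qed.

(** A semisimple module embeds into a power of the sum of simples by linear functionals at its
    vertices. With all arrows zero every submodule has a complement, so the embedding splits. *)
Lemma in_add_simples D M : in_add (simples_sum K D) M <-> semisimple_on D M.
Proof.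
split=> [[m [Z /iso_elim[f [g [fg gf]]]]]|SM].
  apply: (@semisimple_sub _ _ _ (hcomp f (hinl M Z))).
    apply: hom_ker0 => x; rewrite hcompE => h.
    have : hinl M Z x = 0 by apply: (can_inj fg); rewrite h linear0.
    by rewrite hinlE => -[].
  apply: subcat_power; [exact: semisimple_zero|exact: semisimple_dsum|exact: semisimple_simples].
have [M1 M2] := SM.
have [|m [g kg]] := @cogen_intro M (simples_sum K D).
  move=> x /nonzero_idem[i xi].
  have iD : i \in D by apply: contraNT xi => iD; rewrite M2.
  have [phi phi1] := functional_nonzero xi.
  have [|||h hE] := @hom_ex _ _ M (simple_at K i) (phi \o idem M i)%VF.
  - by move=> a y z; rewrite linearP.
  - move=> j y; rewrite comp_lfunE idem_idem /= /simple_idem eq_sym.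
    by case: eqP => [->|_]; rewrite ?id_lfunE ?comp_lfunE // zero_lfunE linear0.
  - by move=> y; rewrite tot_simple M1 linear0.
  have [|f kf] := @simple_in_sum i (enum D); first by rewrite mem_enum.
  exists (hcomp f h); rewrite hcompE hE comp_lfunE phi1.
  apply/eqP => f1; have /eqP : (1 : mspace (simple_at K i)) = 0.
    by apply: (lker0_inj kf); rewrite f1 linear0.
  by rewrite oner_eq0.
set P := power m _ in g kg.
have [P1 P2] : semisimple_on D P.
  apply: subcat_power; [exact: semisimple_zero|exact: semisimple_dsum|exact: semisimple_simples].
have [|W [sW _ WC WCf]] := @complement_ex _ _ P (limg g) 0%VS (Ecat_tot0 P1)
   (submodule_limg g) (submodule0 P) (cap0v _); first by left.
have [Z [f [kf lf]]] := sub_ex sW.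
exists m, Z; apply: iso_sym.
by apply: (iso_dsum_sub kg erefl kf lf); rewrite 1?capvC 1?addvC.
Qed.

End Cogeneration.

(** * Socle and radical of nilpotent modules; rays and corays in terms of arrows *)

Section RayCoray.
Variables (K : fieldType) (n : nat).
Implicit Types (M N X Y Z : cycmod K n) (i j c : 'I_n) (D : {set 'I_n}).

Lemma submodule_tot M : submodule (limg (tot M)).
Proof.
apply/submoduleP; split=> [i|] _ /limgP[x ->]; last exact: mem_limg.
by rewrite -(ord_predK i) idem_tot mem_limg.
Qed.

(** Nakayama: if W + J M = M, then W + J^k M = M for every k by iteration, hence W = M by
    nilpotence. *)
Lemma maximal_tot M (W : {vspace mspace M}) : Ecat M -> maximal_submodule W -> (limg (tot M) <= W)%VS.
Proof.
move=> /Ecat_pw[l Hl] [sW Wf Wmax].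
have [||E|E] := Wmax (W + limg (tot M))%VS.
- exact: submodule_add (submodule_tot M).
- exact: addvSl.
- by rewrite -[X in (_ <= X)%VS]E addvSr.
case: Wf; have H k x : exists2 w, w \in W & exists z, x = w + pw M k z.
  elim: k => [|k [w wW [z ->]]]; first by exists 0; rewrite ?mem0v //; exists x; rewrite pw0 add0r.
  have := memvf z; rewrite -E => /memv_addP[w' wW' [_ /limgP[z' ->] ->]].
  exists (w + pw M k w'); first by rewrite memvD ?submodule_pw.
  by exists z'; rewrite linearD /= -pwSr addrA.
by apply: fullvP => x; have [w wW [z ->]] := H l x; rewrite Hl addr0.
Qed.

(** An element outside J M has a nonzero component at some i modulo J M. A functional that lives at
    i and kills J M but not this component has a maximal submodule as its kernel. *)
Lemma radical_tot M : Ecat M -> is_radical (limg (tot M)).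
Proof.
move=> EM; split=> [W|U HU]; first exact: maximal_tot.
apply/subvP => u uU; apply/negPn/negP => /notin_idem[i ui].
have [psi [psi1 psi0]] := functional_sep ui.
pose phi := (psi \o idem M i)%VF.
have phiE x : phi x = psi (idem M i x) by rewrite comp_lfunE.
have phi1 : phi u = 1 by rewrite phiE psi1.
suff /HU/subvP/(_ u uU) : maximal_submodule (lker phi).
  by rewrite memv_ker phi1 oner_eq0.
split.
- apply/submoduleP; split=> [j|] x; rewrite !memv_ker !phiE => /eqP x0.
    by rewrite idem_idem; case: (eqVneq i j) => [<-|_]; rewrite ?x0 ?linear0.
  by rewrite -(ord_predK i) idem_tot psi0 ?mem_limg.
- by move=> E; have := memvf u; rewrite -E memv_ker phi1 oner_eq0.
move=> W sW kW; have [Wk|/subvPn[w wW]] := boolP (W <= lker phi)%VS.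
  by left; apply/eqP; rewrite eqEsubv Wk kW.
rewrite memv_ker => phiw; right; apply: fullvP => x.
have -> : x = (x - (phi x / phi w) *: w) + (phi x / phi w) *: w by rewrite subrK.
rewrite memvD ?memvZ // (subvP kW) // memv_ker linearB linearZ /=.
by rewrite -[_ *: phi w]/(_ * phi w) divfK // subrr.
Qed.

(** The top is M / J M, so it has no S_i as a summand exactly when the space at i lies in J M. All
    later arguments use this form. *)
Lemma CorayP D M : Coray D M <-> Ecat M /\ forall i x, i \notin D -> exists z, idem M i x = tot M z.
Proof.
split=> [[EM [S [g [[Hg lg] radg /in_add_simples[S1 S2]]]]]|[EM H]]; split=> //.
  move=> i x iD; have [_ /(_ (lker g)) le] := radical_tot EM.
  have /subvP := le (proj1 radg); move/(_ (idem M i x)); rewrite memv_ker.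
  by rewrite (hom_idem (Hom Hg)) S2 // eqxx => /(_ isT)/limgP.
have [S [g [lg kg]]] := quot_ex (submodule_tot M).
exists S, g; split; [by split=> //; exact: homP|by rewrite kg; exact: radical_tot|].
apply/in_add_simples; split=> [y|i y iD]; have [x <-] := limg_full lg y.
  by rewrite -hom_tot; apply/eqP; rewrite -memv_ker kg mem_limg.
rewrite -hom_idem; apply/eqP; rewrite -memv_ker kg.
by have [z ->] := H i x iD; rewrite mem_limg.
Qed.

Lemma submodule_ker_tot M : submodule (lker (tot M)).
Proof.
apply/submoduleP; split=> [i|] x; rewrite !memv_ker => /eqP x0; last by rewrite x0 linear0.
by rewrite -idem_tot x0 linear0.
Qed.

Lemma simple_line M i x : idem M i x = x -> tot M x = 0 -> x != 0 -> simple_submodule <[x]>%VS.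
Proof.
move=> xi xA x0; split.
- apply/submoduleP; split=> [j|] _ /vlineP[a ->]; rewrite linearZ /=.
    by rewrite (idem_hid _ xi) memvZ //; case: ifP; rewrite ?mem0v ?memv_line.
  by rewrite xA scaler0 mem0v.
- by move=> E; case/eqP: x0; apply/eqP; rewrite -memv0 -E memv_line.
move=> W sW Wx; have [->|W0] := eqVneq W 0%VS; first by left.
right; apply/eqP; rewrite eqEdim Wx dim_vline x0 lt0n dimv_eq0 W0 //.
Qed.

(** By nilpotence a simple submodule meets the kernel of [tot M], hence lies in it; conversely a
    nonzero element of the kernel at one vertex spans a simple submodule. *)
Lemma socle_tot M : Ecat M -> is_socle (lker (tot M)).
Proof.
move=> EM; split=> [W [sW W0 Wmin]|U HU].
  have [|E|E] := Wmin (W :&: lker (tot M))%VS (submodule_cap sW (submodule_ker_tot M)).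
  - exact: capvSl.
  - case: W0; apply: NNPP => /eqP; rewrite -vpick0 -memv0 => xW.
    have [k [k0 k1]] := nilp_last EM xW.
    have xW' : vpick W \in W := memv_pick W.
    case/negP: k0; rewrite -E memv_cap submodule_pw //= memv_ker.
    by move: k1; rewrite memv0.
  - by rewrite -E capvSr.
apply/subvP => x; rewrite memv_ker => /eqP x0.
rewrite -(sum_idem x); apply: memv_suml => i _.
have [->|xi] := eqVneq (idem M i x) 0; first by rewrite mem0v.
have /HU/subvP -> // : simple_submodule <[idem M i x]>%VS.
  by apply: (@simple_line _ i); rewrite ?idemK // -idem_tot x0 linear0.
exact: memv_line.
Qed.

Lemma RayP D M : Ray D M <->
  Ecat M /\ forall i x, i \notin D -> tot M (idem M i x) = 0 -> idem M i x = 0.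
Proof.
split=> [[EM [S [f [[Hf kf] socf /in_add_simples[S1 S2]]]]]|[EM H]]; split=> //.
  move=> i x iD x0; have [_ /(_ (limg f)) le] := socle_tot EM.
  have /subvP := le (proj1 socf); move/(_ (idem M i x)); rewrite memv_ker x0 eqxx.
  move=> /(_ isT)/limgP[s E]; rewrite -idemK E -(hom_idem (Hom Hf)) S2 //=.
  by rewrite linear0.
have [S [f [kf lf]]] := sub_ex (submodule_ker_tot M).
have fA s : tot M (f s) = 0 by apply/eqP; rewrite -memv_ker -lf mem_limg.
exists S, f; split; [by split=> //; exact: homP|by rewrite lf; exact: socle_tot|].
apply/in_add_simples; split=> [y|i y iD]; apply: (lker0_inj kf); rewrite linear0.
  by rewrite hom_tot fA.
by rewrite hom_idem H // -hom_idem fA.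
Qed.

End RayCoray.

(** * Torsion pairs of type (1) *)

Section CorayTorsion.
Variables (K : fieldType) (n : nat).
Implicit Types (M N X Y Z : cycmod K n) (i j c : 'I_n) (D : {set 'I_n}).

Definition sincere_on D (A : subcat K n) :=
  forall i, i \in D -> exists Y, A Y /\ exists y, idem Y i y != 0.

(** This supplies the input of [path_hom]: a functional at b that does not vanish on [pw X k x], and
    the greatest L for which it is nonzero on J^L X. The choice of L makes it vanish on J^(L+1) X,
    and L >= k. *)
Lemma longest_path_functional X b k x : Ecat X -> idem X b (pw X k x) != 0 ->
  exists (phi : 'Hom(mspace X, K^o)) L c m,
    [/\ (k <= L)%N, sh L c = b, idem X c m = m, phi (pw X L m) != 0 &
        forall m', phi (pw X L.+1 m') = 0].
Proof.
move=> /Ecat_pw[r Hr] xb; have [phi0 phi01] := functional_nonzero xb.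
pose phi := (phi0 \o idem X b)%VF.
have phiE m : phi m = phi0 (idem X b m) by rewrite comp_lfunE.
have [||L [[m Lm] Lmax]] := @ex_greatest (fun L => exists m, phi (pw X L m) != 0) r.
- by exists k, x; rewrite phiE phi01 oner_neq0.
- move=> l [m]; apply: contraR; rewrite -ltnNge => lr.
  by rewrite (pw_le (ltnW lr)) ?linear0 // Hr.
have [c cm] : exists c, phi (pw X L (idem X c m)) != 0.
  apply: NNPP => no; case/eqP: Lm; rewrite -(sum_idem m) !linear_sum big1 // => c _.
  by apply/eqP/negPn/negP => h; apply: no; exists c.
exists phi, L, c, (idem X c m); split=> //; last 1 first.
- move=> m'; apply/eqP/negPn/negP => h.
  have /Lmax : exists m, phi (pw X L.+1 m) != 0 by exists m'.
  by rewrite ltnn.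
- by apply: Lmax; exists x; rewrite phiE phi01 oner_neq0.
- apply/eqP/negPn/negP => h; case/eqP: cm.
  by rewrite phiE pw_idem idem_idem eq_sym (negPf h) linear0.
exact: idemK.
Qed.

(* A nonzero e_b X would yield a nonzero map from X, through the uniserial module
   with top c and socle b, onto a submodule of a torsion-free module. *)
Lemma sincere_torsion_boundary D (T F : subcat K n) X b x :
  torsion_pair (Omega_mod (~: D)) T F -> sincere_on (~: D) F ->
  ordS b \in D -> T X -> idem X b x = 0.
Proof.
move=> tp sF bD TX; have [[TC FC] _ TF _] := tp.
have dC : ordS b \notin ~: D by rewrite inE negbK.
apply/eqP/negPn/negP; rewrite -(pw0 x).
move=> /(longest_path_functional (Omega_Ecat dC (TC _ TX)))[phi [L [c [m [_ cb mc phim phiL]]]]].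
have cD : c \in ~: D.
  by apply: contraR phim => cD; rewrite -mc (Omega_idem _ (TC _ TX)) // !linear0.
have [Y [FY [y0 yc0]]] := sF c cD; set y := idem Y c y0 in yc0.
have yc : idem Y c y = y by rewrite /y idemK.
(* One step after b the path from c enters D, where Y vanishes. *)
have yL : pw Y L.+1 y = 0.
  by rewrite -(pw_hid L.+1 yc) shS cb (Omega_idem _ (FC _ FY)).
have := proj1 (hom_zeroP _ _) (TF _ _ TX FY) (path_hom yc yL phiL) m.
rewrite path_hom_src ?(Omega_pw _ dC (FC _ FY)) // => /eqP.
by rewrite scaler_eq0 (negPf phim) (negPf yc0).
Qed.

(** G is generated by the spaces at the vertices of D, obtained as a submodule of least dimension
    containing them. With p the projection to these spaces, the image of p plus [tot X] of G is
    again such a submodule, so it is all of G: the top of G lives on D. *)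
Lemma coray_part D X : exists G : {vspace mspace X}, [/\ submodule G,
  forall i x, i \in D -> idem X i x \in G &
  forall i x, i \notin D -> x \in G -> exists2 z, z \in G & idem X i x = tot X z].
Proof.
pose P d := exists G : {vspace mspace X}, [/\ submodule G,
  forall i x, i \in D -> idem X i x \in G & \dim G = d].
have [|d [[G [sG GD dG]] dmin]] := @ex_least P.
  exists (\dim {:mspace X}), fullv; split=> // [|i x _]; last exact: memvf.
  by apply/submoduleP; split=> *; exact: memvf.
have [Ge GA] := proj1 (submoduleP _) sG.
exists G; split=> // i x iD.
have [p [pe pe' pG]] : exists p : 'End(mspace X),
    [/\ forall j y, idem X j (p y) = if j \in D then idem X j y else 0,
        forall j y, p (idem X j y) = if j \in D then idem X j y else 0 &
        forall y, p y \in G].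
  exists (\sum_(i in D) idem X i); split=> [j y|j y|y].
  - rewrite sum_lfunE linear_sum; case: ifP => jD.
      rewrite (bigD1 j) //= idemK big1 ?addr0 // => k /andP[_ kj].
      by rewrite idem_idem eq_sym (negPf kj).
    by rewrite big1 // => k kD; rewrite /= idem_idem; case: eqP => // jk; rewrite jk kD in jD.
  - rewrite sum_lfunE; case: ifP => jD.
      rewrite (bigD1 j) //= idemK big1 ?addr0 // => k /andP[_ kj].
      by rewrite idem_idem (negPf kj).
    by rewrite big1 // => k kD; rewrite idem_idem; case: eqP => // jk; rewrite -jk kD in jD.
  - by rewrite sum_lfunE; apply: memv_suml => j jD; exact: GD.
pose G' := (limg p + tot X @: G)%VS.
have G'G : (G' <= G)%VS.
  apply/subvP => _ /memv_addP[_ /limgP[y ->] [_ /memv_imgP[z zG ->] ->]].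
  by rewrite memvD ?GA.
have sG' : submodule G'.
  apply/submoduleP; split=> [j|] y yG'; last first.
    by apply: (subvP (addvSr _ _)); rewrite memv_img // (subvP G'G).
  move: yG' => /memv_addP[_ /limgP[y1 ->] [_ /memv_imgP[z zG ->] ->]].
  rewrite linearD memv_add //=; first by rewrite pe -pe' mem_limg.
  by rewrite -(ord_predK j) idem_tot memv_img ?Ge.
have /dmin : P (\dim G').
  exists G'; split=> // j y jD; apply: (subvP (addvSl _ _)).
  have -> : idem X j y = p (idem X j y) by rewrite pe' jD.
  exact: mem_limg.
rewrite -dG => le; have /eqP E : G' == G by rewrite eqEdim G'G le.
rewrite -{1}E => /memv_addP[_ /limgP[y1 ->] [_ /memv_imgP[z zG ->] ->]].
exists (idem X (ord_pred i) z); first exact: Ge.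
by rewrite linearD /= pe (negPf iD) add0r -idem_tot ord_predK.
Qed.

Theorem coray_torsion_pair D (T F : subcat K n) : D != set0 ->
  torsion_pair (Omega_mod (~: D)) T F -> sincere_on (~: D) F ->
  torsion_pair (@Ecat K n) (oplus (Coray D) T) F.
Proof.
move=> /set0Pn[d dD] tp sF; have [[TC FC] [Ti Fi] TF _] := tp.
have dC : d \notin ~: D by rewrite inE negbK.
have OE M : Omega_mod (~: D) M -> Ecat M := @Omega_Ecat _ _ _ d M dC.
split.
- split=> [M [A [B [/CorayP[EA _] /TC/OE EB /iso_elim[f [g [fg gf]]]]]]|M /FC/OE //].
  apply: (@Ecat_sub _ _ _ _ f); last exact: Ecat_dsum.
  by apply/eqP/lker0P; exact: can_inj fg.
- split=> // M N MN [A [B [CA TB MAB]]]; exists A, B; split=> //.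
  exact: iso_trans (iso_sym MN) MAB.
- move=> M Y [A [B [/CorayP[EA CA] TB /iso_elim[f [g [fg gf]]]]]] FY; apply/hom_zeroP => h x.
  (* No map leads from a coray to a module off D. Components of z at D die in Y and the others lie
     in J A, so the image of u equals J times itself; nilpotence makes it zero. *)
  have hA (u : hom A Y) a : u a = 0.
    move/Ecat_pw: EA => [l Hl].
    have sur k z : exists z', u z = pw Y k (u z').
      elim: k z => [|k IH] z; first by exists z; rewrite pw0.
      have [z1 Ez1] : exists z1, u z = tot Y (u z1).
        have [w wE] : exists w : 'I_n -> mspace A, forall i, i \notin D -> idem A i z = tot A (w i).
          apply: (fin_all_exists (P := fun i v => i \notin D -> idem A i z = tot A v)) => i.
          have [_|iD] := boolP (i \in D); first by exists 0.
          by have [v ->] := CA i z iD; exists v.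
        exists (\sum_(i | i \notin D) w i).
        rewrite -hom_tot -{1}(sum_idem z) !linear_sum /= (bigID (fun i => i \in D)) /= big1 ?add0r.
          by apply: eq_bigr => i iD; rewrite wE.
        by move=> i iD; rewrite hom_idem (Omega_idem _ (FC _ FY)) // inE negbK.
      have [z' Ez'] := IH z1; exists z'.
      by rewrite Ez1 Ez' -pwS.
    by have [z' ->] := sur l a; rewrite -hom_pw Hl linear0.
  rewrite -(fg x); have -> : f x = hinl A B (f x).1 + hinr A B (f x).2.
    by rewrite hinlE hinrE [LHS]pairE; congr pair; rewrite /= ?addr0 ?add0r.
  rewrite !linearD /=.
  have := hA (hcomp h (hcomp g (hinl A B))) (f x).1; rewrite !hcompE => ->.
  have := proj1 (hom_zeroP _ _) (TF _ _ TB FY) (hcomp h (hcomp g (hinr A B))) (f x).2.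
  by rewrite !hcompE => ->; rewrite addr0.
(* X / G lives off D. The preimage Y in X of its torsion part N is an extension of N by G, with X /
   Y = Z torsion-free. *)
move=> X EX; have [G [sG GD GnD]] := coray_part D X.
have [Q [q [lq kq]]] := quot_ex sG.
have CQ : Omega_mod (~: D) Q.
  apply: Omega_intro => i y; rewrite inE negbK => iD; have [x <-] := limg_full lq y.
  by rewrite -hom_idem; apply/eqP; rewrite -memv_ker kq GD.
have [N [Z [f [p [TN FZ kf lp fp]]]]] := tp_seq tp CQ.
pose r := hcomp p q.
have [Y [j [kj lj]]] := sub_ex (submodule_lker r).
have [|k kE] := @factor_mono _ _ _ _ _ f (hcomp q j) kf.
  by move=> y; rewrite fp memv_ker hcompE -hcompE -memv_ker -/r -lj mem_limg.
have lk : limg k = fullv.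
  apply: limg_full_intro => v; have [x qx] := limg_full lq (f v).
  have /limgP[y xy] : x \in limg j.
    by rewrite lj memv_ker hcompE qx -memv_ker -fp mem_limg.
  by exists y; apply: (lker0_inj kf); rewrite kE hcompE -xy.
have kG y : (k y == 0) = (j y \in G).
  rewrite -kq memv_ker -hcompE -kE; apply/eqP/eqP => [->|h]; first by rewrite linear0.
  by apply: (lker0_inj kf); rewrite h linear0.
have Gj g : g \in G -> exists2 y, y \in lker k & g = j y.
  move=> gG; have /limgP[y gy] : g \in limg j.
    by rewrite lj memv_ker hcompE; move: gG; rewrite -kq memv_ker => /eqP ->; rewrite linear0.
  by exists y => //; rewrite memv_ker kG -gy.
have EY := Ecat_sub kj EX.
(* The extension Y of N by G splits. For i in D the space of Y at i lies in G; if [ordS i] is in D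
   the same holds because N vanishes at i; for every other i the arrow maps G at i onto G at
   [ordS i], as the top of G lives on D. *)
have [||W [sW _ WC WCf]] := @complement_ex _ _ Y (lker k) 0%VS EY (submodule_lker k) (submodule0 Y).
- exact: cap0v.
- right=> i; have [iD|iD] := boolP (i \in D).
    by left=> y; rewrite memv_ker kG hom_idem GD.
  have [iD'|iD'] := boolP (ordS i \in D).
    left=> y; rewrite memv_ker hom_idem.
    by rewrite (sincere_torsion_boundary _ tp sF iD' TN).
  right=> z zC; have zG : j z \in G by rewrite -kG -memv_ker.
  have [_ /Gj[y yC ->] E] := GnD _ _ iD' zG.
  exists y => //; rewrite -idem_tot; apply: (lker0_inj kj).
  by rewrite !hom_idem hom_tot -E idemK.
have [A [a [ka la]]] := sub_ex (submodule_lker k).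
have [B [b [kb lb]]] := sub_ex sW.
exists Y, Z, j, r; split=> //; last first.
  by apply: short_exact_intro => //; apply: limg_full_intro => z;
     have [y <-] := limg_full lp z; have [x <-] := limg_full lq y; exists x; rewrite hcompE.
exists A, B; split.
- apply/CorayP; split=> [|i x iD]; first exact: Ecat_sub ka EY.
  have xG : j (a x) \in G by rewrite -kG -memv_ker -la mem_limg.
  have [_ /Gj[y yC ->] E] := GnD _ _ iD xG.
  move: yC; rewrite -la => /limgP[z yz]; exists z.
  by apply: (lker0_inj ka); apply: (lker0_inj kj); rewrite !hom_idem E yz !hom_tot.
- apply: Ti TN; apply: iso_sym; apply: (@iso_intro _ _ _ _ (hcomp k b)).
    apply: hom_ker0 => x; rewrite hcompE => kx.
    have : b x \in (W :&: lker k)%VS by rewrite memv_cap -lb mem_limg memv_ker kx /=.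
    by rewrite WC memv0 => /eqP bx; apply: (lker0_inj kb); rewrite bx linear0.
  apply: limg_full_intro => v; have [y <-] := limg_full lk v.
  have := memvf y; rewrite -WCf -lb => /memv_addP[_ /limgP[x ->] [c cC ->]].
  by exists x; rewrite hcompE linearD /=; move: cC; rewrite memv_ker => /eqP ->; rewrite addr0.
by apply: (iso_dsum_sub ka la kb lb); rewrite 1?capvC 1?addvC.
Qed.

End CorayTorsion.

(** * Injective modules and approximations *)

Section Injectives.
Variables (K : fieldType) (n : nat) (D : {set 'I_n}) (d : 'I_n).
Hypothesis dD : d \in D.
Implicit Types (M N X Y Z : cycmod K n) (i j c : 'I_n).
Local Notation C := (@Omega_mod K n (~: D)).

(** A criterion for injectivity among modules off D, as [arrows_into] is one for projectivity.
    Arrows between a vertex off D and one of D satisfy both conditions trivially, since such modules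
    vanish on D. *)
Definition arrows_onto M :=
  forall i z, i \notin D -> exists w, tot M (idem M i w) = idem M (ordS i) z.

Definition arrows_into M :=
  forall i x, ordS i \notin D -> tot M (idem M i x) = 0 -> idem M i x = 0.

Let dC : d \notin ~: D. Proof. by rewrite inE negbK. Qed.

Lemma Omega_idem0 M i x : C M -> i \in D -> idem M i x = 0.
Proof. by move=> CM iD; rewrite (Omega_idem _ CM) // inE negbK. Qed.

(** In Y + I the image of X under (f, h) meets the summand I trivially. A complement of I containing
    this image is the graph of a map Y -> I, and that map extends h. *)
Lemma arrows_onto_extend X Y I (f : hom X Y) (h : hom X I) : C Y -> C I -> arrows_onto I ->
  lker f = 0%VS -> exists h' : hom Y I, forall x, h' (f x) = h x.
Proof.
move=> CY CI sI kf; pose E := dsum Y I.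
have CE : C E by exact: Omega_dsum.
have [||W [sW GW WC WCf]] := @complement_ex _ _ E (lker (hfst Y I)) (limg (hpair f h))
  (Omega_Ecat dC CE) (submodule_lker _) (submodule_limg _).
- apply/eqP; rewrite -subv0; apply/subvP => _ /memv_capP[/limgP[x ->]].
  rewrite memv_ker hfstE hpairE /= => /eqP fx.
  have -> : x = 0 by apply: (lker0_inj kf); rewrite fx linear0.
  by rewrite !linear0 mem0v.
- right=> i; have [iD|iD] := boolP (i \in D).
    by left=> y; rewrite Omega_idem0 // mem0v.
  right=> z; rewrite memv_ker hfstE => /eqP z1; have [w wE] := sI i z.2 iD.
  exists (0, w); first by rewrite memv_ker hfstE.
  by rewrite !dsum_idemE dsum_totE /= wE z1 !linear0.
have [S [j [kj lj]]] := sub_ex sW.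
pose k := hcomp (hfst Y I) j; have kE s : k s = hfst Y I (j s) := hcompE _ _ _.
have kk : lker k = 0%VS.
  apply: hom_ker0 => x; rewrite kE => jx; apply: (lker0_inj kj); rewrite linear0.
  by apply/eqP; rewrite -memv0 -WC memv_cap -lj mem_limg memv_ker jx /=.
have [|k' k'E] := @factor_mono _ _ _ _ _ k (hid Y) kk.
  move=> y; have := memvf ((y, 0) : mspace E); rewrite -WCf -lj.
  move=> /memv_addP[_ /limgP[s ->] [c cC E1]].
  have -> : hid Y y = k s; last exact: mem_limg.
  have : hfst Y I (y, 0) = hfst Y I (j s + c) by rewrite E1.
  rewrite linearD {1}hfstE hidE kE /= => ->.
  by move: cC; rewrite memv_ker => /eqP ->; rewrite addr0.
exists (hcomp (hsnd Y I) (hcomp j k')) => x; rewrite !hcompE.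
have /limgP[s sE] : hpair f h x \in limg j by rewrite lj (subvP GW) ?mem_limg.
have -> : k' (f x) = s.
  apply: (lker0_inj kk); rewrite k'E hidE kE -sE hfstE hpairE //.
by rewrite -sE hsndE hpairE.
Qed.

Lemma arrows_onto_injective I : C I -> arrows_onto I -> injective_in C I.
Proof.
move=> CI sI; split=> // X Y f h CX CY [Hf kf] Hh.
have [h' hE] := @arrows_onto_extend X Y I (Hom Hf) (Hom Hh) CY CI sI kf.
exists h'; split; first exact: homP.
by apply/lfunP => x; rewrite comp_lfunE hE.
Qed.

Lemma arrows_onto_quot M N (f : hom M N) : limg f = fullv -> arrows_onto M -> arrows_onto N.
Proof.
move=> lf sM i z iD; have [x <-] := limg_full lf z; have [w wE] := sM i x iD.
by exists (f w); rewrite -!hom_idem -wE hom_tot.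
Qed.

Lemma arrows_onto_dsum M N : arrows_onto M -> arrows_onto N -> arrows_onto (dsum M N).
Proof.
move=> sM sN i z iD; have [w wE] := sM i z.1 iD; have [v vE] := sN i z.2 iD.
by exists (w, v); rewrite !dsum_idemE dsum_totE /= wE vE.
Qed.

Lemma arrows_onto_zero Z : (forall z : mspace Z, z = 0) -> arrows_onto Z.
Proof. by move=> z0 i z _; exists 0; exact: etrans (z0 _) (esym (z0 _)). Qed.

Lemma Omega_zero Z : (forall z : mspace Z, z = 0) -> C Z.
Proof. by move=> z0; apply: Omega_intro => *; exact: z0. Qed.

(** The path algebra is hereditary: surjectivity of the arrows passes to quotients, so the cokernel
    of an embedding into a power of I is again injective. *)
Lemma id_le1_all I X : C I -> arrows_onto I ->
  (forall x : mspace X, x != 0 -> exists h : hom X I, h x != 0) -> id_le1 C X.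
Proof.
move=> CI sI coI; have [m [g kg]] := cogen_intro coI.
have CP : C (power m I) by apply: subcat_power CI; [exact: Omega_zero|exact: Omega_dsum].
have sP : arrows_onto (power m I).
  by apply: subcat_power sI; [exact: arrows_onto_zero|exact: arrows_onto_dsum].
have [Q [q [lq kq]]] := quot_ex (submodule_limg g).
exists (power m I), Q, g, q; split; first exact: arrows_onto_injective.
  apply: arrows_onto_injective; first exact: Omega_quot lq CP.
  exact: arrows_onto_quot lq sP.
exact: short_exact_intro.
Qed.

(** * Minimal approximations by torsion-free modules *)

Section Approximation.
Variables (T F : subcat K n) (I P : cycmod K n).
Hypothesis tp : torsion_pair C T F.
Hypothesis sF : sincere_on (~: D) F.
Hypotheses (CI : C I) (sI : arrows_onto I) (CP : C P) (iP : arrows_into P).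
Hypothesis gP : forall X, C X -> forall x : mspace X, exists (h : hom P X) p, h p = x.

Let FC X : F X -> C X. Proof. by move=> /(torsionfreeP _ tp)[]. Qed.

(** Follow a nonzero element in the image of a torsion module to its last nonzero multiple. As the
    arrows of P are injective, it sits at a vertex j with [ordS j] in D, where torsion modules
    vanish. *)
Lemma arrows_into_torsionfree : F P.
Proof.
apply/(torsionfreeP _ tp); split=> // X TX; apply/hom_zeroP => h x.
apply/eqP/negPn/negP => /nonzero_idem[i]; rewrite -hom_idem -memv0 => hx.
have [k [kx kx']] := nilp_last (Omega_Ecat dC CP) hx.
move: kx kx'; rewrite -hom_pw; set x' := pw X k _; set j := sh k i.
have xj : idem X j x' = x' by rewrite pw_hid ?idemK.
rewrite !memv0 => hx0 /eqP hx1; case/negP: hx0.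
have [jD|jD] := boolP (ordS j \in D).
  by rewrite -xj (sincere_torsion_boundary _ tp sF jD TX) linear0.
by rewrite -xj hom_idem iP // -hom_idem xj.
Qed.

Definition approximation F0 (f0 : hom F0 I) :=
  F F0 /\ forall X, F X -> forall h : hom X I, exists g : hom X F0, forall x, f0 (g x) = h x.

(** An element of F0 at c killed by [pw F0 l] is a map into F0 from the uniserial module of length l
    with top at c. This space records which such maps into I factor through f0. Lengths up to n
    suffice off D, hence the index in ['I_n.+1]. *)
Definition source_part F0 (f0 : hom F0 I) (p : 'I_n * 'I_n.+1) : {vspace mspace I} :=
  (f0 @: (limg (idem F0 p.1) :&: lker (pw F0 p.2)))%VS.

Lemma source_partP F0 (f0 : hom F0 I) (p : 'I_n * 'I_n.+1) z : reflect
  (exists u, [/\ idem F0 p.1 u = u, pw F0 p.2 u = 0 & z = f0 u]) (z \in source_part f0 p).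
Proof.
apply: (iffP memv_imgP) => [[u]|[u [u1 u2 ->]]]; last first.
  by exists u; rewrite // memv_cap memv_ker u2 eqxx -u1 mem_limg.
rewrite memv_cap memv_ker => /andP[/limgP[v ->] /eqP uk] ->.
by exists (idem F0 p.1 v); rewrite idemK.
Qed.

(* A map out of X into I factors through F0 as soon as it does so on the uniserial
   summands of X; maximality makes every F0 + Y contribute nothing new. *)
Lemma approximation_ex : exists F0 (f0 : hom F0 I), approximation f0.
Proof.
pose mu F0 (f0 : hom F0 I) := (\sum_p \dim (source_part f0 p))%N.
have [Z z0] := zero_ex K n.
have [||m [[F0 [f0 [FF0 m0]]] mmax]] :=
  @ex_greatest (fun m => exists F0 (f0 : hom F0 I), F F0 /\ mu F0 f0 = m)
    (\sum_(p : 'I_n * 'I_n.+1) \dim {:mspace I})%N.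
- exists (mu Z (hzero Z I)), Z, (hzero Z I); split=> //.
  exact: torsionfree_zero tp (Omega_zero z0) z0.
- by move=> _ [F0 [f0 [_ <-]]]; apply: leq_sum => p _; apply: dimvS; exact: subvf.
(* If [h y] were not yet reached, replacing F0 by F0 + Y would enlarge the part at (c, l) without
   shrinking any other, against the maximality of [mu]. *)
have key Y (h : hom Y I) c y l : F Y -> idem Y c y = y -> pw Y l y = 0 -> (l <= n)%N ->
    exists u, [/\ idem F0 c u = u, pw F0 l u = 0 & h y = f0 u].
  move=> FY yc yl ln; pose p : 'I_n * 'I_n.+1 := (c, Ordinal (ln : (l < n.+1)%N)).
  suff : h y \in source_part f0 p by move/source_partP.
  apply/negPn/negP => hy; pose f1 := hcopair f0 h.
  have FD : F (dsum F0 Y).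
    by apply: (torsionfree_dsum tp) => //; apply: Omega_dsum; exact: FC.
  have sub q : (source_part f0 q <= source_part f1 q)%VS.
    apply/subvP => z /source_partP[u [u1 u2 ->]]; apply/source_partP; exists (u, 0).
    by rewrite dsum_idemE dsum_pwE hcopairE /= u1 u2 !linear0 addr0.
  have hy1 : h y \in source_part f1 p.
    apply/source_partP; exists (0, y).
    by rewrite dsum_idemE dsum_pwE hcopairE /= yc yl !linear0 add0r.
  have /mmax : exists F2 (f2 : hom F2 I), F F2 /\ mu F2 f2 = mu (dsum F0 Y) f1 by exists (dsum F0 Y), f1.
  rewrite -m0 leqNgt => /negP; apply; rewrite /mu (bigD1 p) //= [X in (_ < X)%N](bigD1 p) //=.
  rewrite -addSn leq_add ?leq_sum //; last by move=> q _; exact: dimvS.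
  rewrite ltnNge; apply: contra hy => le.
  have /eqP -> // : source_part f0 p == source_part f1 p by rewrite eqEdim sub.
(* Idempotent endomorphisms stand for direct summands of X, so the induction runs on the rank of e
   with X fixed. *)
suff fac r X (h : hom X I) (e : hom X X) : F X -> (forall x, e (e x) = e x) ->
    (\dim (limg e) <= r)%N -> exists g : hom X F0, forall x, f0 (g x) = h (e x).
  exists F0, f0; split=> // X FX h.
  have [|g gE] := fac (\dim (limg (hid X))) X h (hid X) FX _ (leqnn _).
    by move=> x; rewrite !hidE.
  by exists g => x; rewrite gE hidE.
elim: r X h e => [|r IH] X h e FX ee dr.
  exists (hzero X F0) => x; rewrite hzeroE linear0.
  suff -> : e x = 0 by rewrite linear0.
  by apply/eqP; rewrite -memv0; move: dr; rewrite leqn0 dimv_eq0 => /eqP <-; rewrite mem_limg.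
have [e0|e0] := eqVneq (limg e) 0%VS; first by apply: IH => //; rewrite e0 dimv0.
(* An element of e X surviving a path of the greatest possible length L generates a uniserial direct
   summand, split off by a functional detecting the end of the path. *)
have [||L [[m' Lm] Lmax]] := @ex_greatest (fun L => exists m, pw X L (e m) != 0) n.
- move: e0; rewrite -vpick0 => v0; exists 0%N.
  have /limgP[v vE] : vpick (limg e) \in limg e := memv_pick _.
  by exists v; rewrite pw0 -vE.
- move=> k [v]; apply: contraR; rewrite -ltnNge => kn.
  by rewrite (pw_le (ltnW kn)) // (Omega_pw _ dC (FC FX)).
have Ln : (L < n)%N.
  by rewrite ltnNge; apply: contra Lm => nL; rewrite (pw_le nL) // (Omega_pw _ dC (FC FX)).
have L1 v : pw X L.+1 (e v) = 0.
  apply/eqP/negPn/negP => hv.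
  by have /Lmax : exists m, pw X L.+1 (e m) != 0 by [exists v]; rewrite ltnn.
have [c cm] : exists c, pw X L (e (idem X c m')) != 0.
  apply: NNPP => no; case/eqP: Lm; rewrite -(sum_idem m') !linear_sum big1 // => c _.
  by apply/eqP/negPn/negP => hc; apply: no; exists c.
set x := e _ in cm; have xc : idem X c x = x by rewrite /x -hom_idem idemK.
have ex : e x = x by rewrite /x ee.
have xL : pw X L.+1 x = 0 by exact: L1.
have xn : pw X n x = 0 by rewrite (Omega_pw _ dC (FC FX)).
have [phi0 phi01] := functional_nonzero cm.
pose phi := (phi0 \o e)%VF.
have phiE v : phi v = phi0 (e v) by rewrite comp_lfunE.
have phiL v : phi (pw X L.+1 v) = 0 by rewrite phiE hom_pw L1 linear0.
have [u [uc uL hu]] := key X h c x L.+1 FX xc xL Ln.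
(* s projects onto the summand generated by x. Replacing x by u, which has the same image in I,
   lifts [h] after s to F0. The induction continues with the idempotent e - s, whose image misses
   x. *)
pose s := path_hom xc xL phiL; pose g1 := path_hom uc uL phiL.
have f0g1 v : f0 (g1 v) = h (s v).
  rewrite !path_homE !linear_sum; apply: eq_bigr => k _.
  by rewrite !linearZ /= !hom_pw hu.
have sx : s x = x.
  by rewrite path_hom_src // phiE hom_pw ex phi01 scale1r.
have sfix v : s (s v) = s v.
  rewrite {2 3}/s path_homE linear_sum; apply: eq_bigr => k _ /=.
  by rewrite linearZ /= hom_pw sx.
have es v : e (s v) = s v.
  rewrite path_homE linear_sum; apply: eq_bigr => k _ /=.
  by rewrite linearZ /= hom_pw ex.
have se v : s (e v) = s v.
  rewrite !path_homE; apply: eq_bigr => k _; congr (_ *: _).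
  by rewrite !phiE !hom_pw !hom_idem ee.
pose e' := hadd e (hopp s).
have e'E v : e' v = e v - s v by rewrite haddE hoppE.
have [||g2 g2E] := IH X h e' FX.
- by move=> v; rewrite !e'E !linearB /= ee es se sfix subrr ?subr0 ?addr0.
- rewrite -ltnS; apply: leq_trans dr; rewrite ltnNge; apply/negP => le.
  have sub : (limg e' <= limg e)%VS.
    by apply/subvP => _ /limgP[v ->]; rewrite e'E -es -linearB mem_limg.
  have : x \in limg e' by have /eqP -> : limg e' == limg e by [rewrite eqEdim sub]; rewrite -ex mem_limg.
  move=> /limgP[v xv]; case/eqP: cm.
  suff -> : x = 0 by rewrite linear0.
  have : s x = 0 by rewrite {1}xv e'E linearB /= se sfix subrr.
  by rewrite sx.
exists (hadd g1 g2) => v; rewrite haddE linearD /= f0g1 g2E e'E linearB /=.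
by rewrite addrC subrK.
Qed.

(* Ext^1(X, V) = 0 for all torsion-free X, in a form that absorbs pushouts. *)
Definition extends_to V := forall B E X (f : hom B E) (p : hom E X) (h : hom B V),
  F X -> C E -> lker f = 0%VS -> limg p = fullv -> limg f = lker p ->
  exists h' : hom E V, forall b, h' (f b) = h b.

(** Least dimension is what makes Ext vanish: a pushout along F0 is torsion-free and maps to I,
    hence maps back to F0 over I, and by minimality this splits the inclusion of F0. Surjectivity of
    f0 comes from the torsion-free generator P. *)
Lemma coresolution_ex : exists F0 F1 (k : hom F1 F0) (f0 : hom F0 I),
  [/\ approximation f0, F F1, lker k = 0%VS, limg f0 = fullv & limg k = lker f0] /\
  (extends_to F0 /\ extends_to F1).
Proof.
have [|r [[F0 [f0 [apx dr]]] rmin]] :=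
  @ex_least (fun r => exists F0 (f0 : hom F0 I), approximation f0 /\ \dim {:mspace F0} = r).
  by have [F0 [f0 H]] := approximation_ex; exists (\dim {:mspace F0}), F0, f0.
have [FF0 fac] := apx.
(* The image of an endomorphism over I is again an approximation, so it cannot be smaller than
   F0. *)
have auto (t : hom F0 F0) : (forall x, f0 (t x) = f0 x) -> lker t = 0%VS /\ limg t = fullv.
  move=> tE; have [S [j [kj lj]]] := sub_ex (submodule_limg t).
  have lt : limg t = fullv.
    apply/eqP; rewrite eqEdim subvf -lj limg_dim_eq ?kj ?capv0 // dr.
    apply: rmin; exists S, (hcomp f0 j); split=> //; split.
      exact: torsionfree_sub tp (@Omega_sub _ _ _) kj FF0.
    move=> X FX h; have [g gE] := fac X FX h.
    have [|g' g'E] := @factor_mono _ _ _ _ _ j (hcomp t g) kj.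
      by move=> x; rewrite hcompE lj mem_limg.
    by exists g' => x; rewrite hcompE g'E hcompE tE gE.
  split=> //; apply/eqP; rewrite -dimv_eq0 -(eqn_add2r (\dim (limg t))).
  by rewrite -{1}(capfv (lker t)) limg_ker_dim lt add0n.
have lf0 : limg f0 = fullv.
  apply: limg_full_intro => z; have [h [p <-]] := gP CI z.
  by have [g gE] := fac P arrows_into_torsionfree h; exists (g p).
have [F1 [k [kk lk]]] := sub_ex (submodule_lker f0).
have FF1 : F F1 by exact: torsionfree_sub tp (@Omega_sub _ _ _) kk FF0.
have ext0 : extends_to F0.
  move=> B E X f p h FX CE kf lp fp.
  (* I is injective, so [f0] after h extends to E. Hence the pushout G of f and h also maps to I,
     compatibly with f0. *)
  have [e eE] := arrows_onto_extend (hcomp f0 h) CE CI sI kf.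
  pose w := hpair f (hopp h).
  have [G [q [lq kq]]] := quot_ex (submodule_limg w).
  have CG : C G by apply: Omega_quot lq _; exact: Omega_dsum CE (FC FF0).
  pose i2 := hcomp q (hinr E F0).
  have ki2 : lker i2 = 0%VS.
    apply: hom_ker0 => x; rewrite hcompE hinrE => /eqP; rewrite -memv_ker kq.
    move=> /limgP[b]; rewrite hpairE hoppE => -[/esym fb ->].
    by have -> : b = 0 by [apply: (lker0_inj kf); rewrite fb linear0]; rewrite linear0 oppr0.
  have [|p' p'E] := @factor_epi _ _ _ _ _ q (hcomp p (hfst E F0)) lq.
    move=> x /eqP; rewrite -memv_ker kq hcompE hfstE => /limgP[b ->]; rewrite hpairE /=.
    by apply/eqP; rewrite -memv_ker -fp mem_limg.
  have FG : F G.
    apply: (torsionfree_ext (f := i2) (g := p') tp ki2 _ CG FF0 FX).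
    apply/vspaceP => y; rewrite memv_ker; apply/idP/eqP => [/limgP[x ->]|].
      by rewrite hcompE p'E hcompE hinrE hfstE linear0.
    have [x <-] := limg_full lq y; rewrite p'E hcompE hfstE => /eqP.
    rewrite -memv_ker -fp => /limgP[b xb].
    suff -> : q x = i2 (x.2 + h b) by exact: mem_limg.
    apply/eqP; rewrite -subr_eq0 hcompE -linearB -memv_ker kq.
    suff -> : (x - hinr E F0 (x.2 + h b))%R = w b by exact: mem_limg.
    rewrite hinrE hpairE hoppE [LHS]pairE; congr pair; rewrite /= ?subr0 //.
    by rewrite opprD addrA subrr add0r.
  have [|e' e'E] := @factor_epi _ _ _ _ _ q (hcopair e f0) lq.
    move=> x /eqP; rewrite -memv_ker kq hcopairE => /limgP[b ->]; rewrite hpairE /=.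
    by rewrite eE hcompE hoppE linearN subrr.
  (* G is an extension of X by F0, so it is torsion-free and its map to I factors through F0.
     Restricted to F0 the factorisation is an automorphism, whose inverse t corrects the extension
     of h. *)
  have [g gE] := fac G FG e'.
  have [|kt lt] := auto (hcomp g i2).
    by move=> x; rewrite hcompE gE hcompE e'E hcopairE hinrE /= linear0 add0r.
  have [|t tE] := @factor_mono _ _ _ _ _ (hcomp g i2) (hid F0) kt.
    by move=> x; rewrite lt memvf.
  exists (hcomp t (hcomp g (hcomp q (hinl E F0)))) => b.
  rewrite !hcompE; apply: (lker0_inj kt); rewrite tE hidE hcompE; congr (g _).
  rewrite hcompE; apply/eqP; rewrite -subr_eq0 -linearB -memv_ker kq.
  suff -> : (hinl E F0 (f b) - hinr E F0 (h b))%R = w b by exact: mem_limg.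
  by rewrite hinlE hinrE hpairE hoppE; congr pair; rewrite /= ?subr0 ?sub0r.
(* For F1, h is extended as a map k' into F0. Then [f0] after k' factors through X and lifts there
   to F0; subtracting this lift moves k' into the kernel F1 without changing it on B. *)
exists F0, F1, k, f0; split=> //; split=> // B E X f p h FX CE kf lp fp.
have [k' k'E] := ext0 _ _ _ f p (hcomp k h) FX CE kf lp fp.
have [|s sE] := @factor_epi _ _ _ _ _ p (hcomp f0 k') lp.
  move=> x /eqP; rewrite -memv_ker -fp => /limgP[b ->].
  by rewrite hcompE k'E hcompE; apply/eqP; rewrite -memv_ker -lk mem_limg.
have [g gE] := fac X FX s.
pose v := hadd k' (hopp (hcomp g p)).
have vE x : v x = k' x - g (p x) by rewrite haddE hoppE hcompE.
have [|h' h'E] := @factor_mono _ _ _ _ _ k v kk.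
  by move=> x; rewrite lk memv_ker vE linearB /= gE sE hcompE subrr.
exists h' => b; apply: (lker0_inj kk); rewrite h'E vE k'E hcompE.
have -> : p (f b) = 0 by apply/eqP; rewrite -memv_ker -fp mem_limg.
by rewrite linear0 subr0.
Qed.

End Approximation.
End Injectives.

(** * Path modules and cotilting modules *)

Lemma hom_ex_arrow (K : fieldType) n (M N : cycmod K n) (f : mspace M -> mspace N) : linear f ->
  (forall i x, f (idem M i x) = idem N i (f x)) ->
  (forall i x, f (arrow M i x) = arrow N i (f x)) -> {h : hom M N | h =1 f}.
Proof.
move=> lf fe fA; have h1 := linfun_linE lf.
suff P : is_hom (linfun f : 'Hom(mspace M, mspace N)) by exists (Hom P).
by split=> *; rewrite !h1.
Qed.

Section PathModules.
Variables (K : fieldType) (n : nat) (D : {set 'I_n}) (d : 'I_n).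
Hypothesis dD : d \in D.
Implicit Types (M N X Y Z : cycmod K n) (i j c : 'I_n) (p q : qpath (~: D)).
Local Notation C := (@Omega_mod K n (~: D)).

Lemma qpath_mem p k : (k <= plen p)%N -> sh k (psrc p) \notin D.
Proof.
move=> kp; have kn : (k < n)%N by apply: leq_ltn_trans kp (ltn_ord _).
by have /forallP/(_ (Ordinal kn)) := valP p; rewrite kp inE.
Qed.

Lemma psrc_mem p : psrc p \notin D. Proof. exact: (@qpath_mem p 0). Qed.
Lemma ptgt_mem p : ptgt p \notin D. Proof. exact: (@qpath_mem p (plen p)). Qed.

Lemma qpath_inj p q : psrc p = psrc q -> plen p = plen q -> p = q.
Proof.
move=> s l; apply: val_inj; rewrite [LHS]surjective_pairing [RHS]surjective_pairing.
by congr pair => //; apply: val_inj.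
Qed.

(* The length bound in qpath is harmless: a longer path would run through d. *)
Lemma qpath_ex i l : (forall k, (k <= l)%N -> sh k i \notin D) ->
  exists p, psrc p = i /\ plen p = l.
Proof.
move=> H; have [k kn kd] := sh_to i d.
have ln : (l < n)%N.
  apply: leq_trans (ltnW kn); rewrite ltnNge; apply/negP => kl.
  by have := H k kl; rewrite kd dD.
have P : path_in (~: D) (i, Ordinal ln).
  by apply/forallP => m; apply/implyP => ml; rewrite inE; exact: H.
by exists (exist (fun u : 'I_n * 'I_n => path_in (~: D) u) _ P : qpath (~: D)).
Qed.

Lemma qpath_trivial i : i \notin D -> exists p, psrc p = i /\ plen p = 0%N.
Proof. by move=> iD; apply: qpath_ex => k; rewrite leqn0 => /eqP ->. Qed.

Lemma qpath_next p : ordS (ptgt p) \notin D -> exists q, psrc q = psrc p /\ plen q = (plen p).+1.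
Proof.
move=> pD; apply: qpath_ex => k; rewrite leq_eqVlt => /orP[/eqP -> //|].
by rewrite ltnS; exact: qpath_mem.
Qed.

Lemma qpath_prev p i : psrc p = ordS i -> i \notin D -> exists q, psrc q = i /\ plen q = (plen p).+1.
Proof.
move=> pi iD; apply: qpath_ex => -[//|k]; rewrite ltnS shSr -pi; exact: qpath_mem.
Qed.

Lemma regular_Omega : C (regular K (~: D)).
Proof.
apply: Omega_intro => i f; rewrite inE negbK => iD; apply/ffunP => q.
rewrite reg_idemE ffunE; case: eqP => // qi.
by have := ptgt_mem q; rewrite qi iD.
Qed.

Lemma dual_regular_Omega : C (dual_regular K (~: D)).
Proof.
apply: Omega_intro => i f; rewrite inE negbK => iD; apply/ffunP => q.
rewrite dreg_idemE ffunE; case: eqP => // qi.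
by have := psrc_mem q; rewrite qi iD.
Qed.

Lemma regular_arrows_into : arrows_into D (regular K (~: D)).
Proof.
move=> i f iD; rewrite tot_idem => f0; apply/ffunP => p.
rewrite reg_idemE ffunE; case: eqP => // pi.
have [|q [qs ql]] := @qpath_next p; first by rewrite pi.
have := @reg_arrowE K n (~: D) i f q; rewrite [reg_arrow _ _ _ _]f0 ffunE (big_pred1 p) // => r.
rewrite /arrow_path qs ql; apply/and3P/eqP => [[_ /eqP rs /eqP[rl]]|->].
  exact: qpath_inj.
by rewrite pi !eqxx.
Qed.

(** The preimage takes at p a_i the value of z at p; removing the first arrow recovers p, so each
    sum has at most one term. *)
Lemma dual_regular_arrows_onto : arrows_onto D (dual_regular K (~: D)).
Proof.
move=> i z iD; exists [ffun q => \sum_(p | path_arrow p i q) z p].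
rewrite tot_idem; apply/ffunP => p.
rewrite [LHS]dreg_arrowE [RHS]dreg_idemE; case: eqP => [pi|pi]; last first.
  by rewrite big1 // => q /and3P[/eqP].
have [q [qs ql]] := qpath_prev pi iD.
rewrite (big_pred1 q) => [|r].
  rewrite ffunE (big_pred1 p) // => r; rewrite /path_arrow qs ql.
  apply/and3P/eqP => [[/eqP rs _ /eqP[rl]]|->]; last by rewrite pi !eqxx.
  by apply: qpath_inj; rewrite ?rs.
rewrite /path_arrow pi eqxx /=; apply/andP/eqP => [[/eqP rs /eqP rl]|->]; last by rewrite qs ql !eqxx.
by apply: qpath_inj; rewrite ?rs ?rl ?qs ?ql.
Qed.

(** The map a |-> a x on the path algebra, where [v q] is the path q applied to x. *)
Lemma regular_generates X (x : mspace X) : C X -> exists (h : hom (regular K (~: D)) X) f, h f = x.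
Proof.
move=> CX; pose v q := pw X (plen q) (idem X (psrc q) x).
have vt q : idem X (ptgt q) (v q) = v q by apply: pw_hid; rewrite idemK.
have [|||h hE] := @hom_ex_arrow K n (regular K (~: D)) X (fun f => \sum_q f q *: v q).
- move=> a f g; rewrite scaler_sumr -big_split; apply: eq_bigr => q _ /=.
  by rewrite !ffunE scalerA scalerDl.
- move=> i f; rewrite linear_sum; apply: eq_bigr => q _; rewrite reg_idemE linearZ /=.
  by rewrite (idem_hid _ (vt q)) eq_sym; case: eqP; rewrite ?scale0r ?scaler0.
- move=> i f; rewrite linear_sum /=.
  under eq_bigr do rewrite reg_arrowE scaler_suml.
  rewrite (exchange_big_dep xpredT) //=; apply: eq_bigr => p _.
  rewrite -scaler_sumr linearZ /=; congr (_ *: _).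
  rewrite -tot_idem (idem_hid _ (vt p)); case: eqP => [pi|pi]; last first.
    by rewrite linear0 big1 // => q /and3P[/eqP E _ _]; rewrite E in pi.
  have vS : tot X (v p) = pw X (plen p).+1 (idem X (psrc p) x) by rewrite pwS.
  (* A path that would enter D has no prolongation, and on the other side X vanishes there. *)
  have [iD|iD] := boolP (ordS i \in D).
    rewrite vS -(@pw_hid K n X _ (psrc p)) ?idemK // shS -[sh _ _]/(ptgt p) -pi.
    rewrite (Omega_idem0 _ CX) // big1 // => q /and3P[_ /eqP qs /eqP ql].
    by have := ptgt_mem q; rewrite /ptgt ql qs /= -/(ptgt p) -pi iD.
  have [|q [qs ql]] := @qpath_next p; first by rewrite -pi.
  rewrite (big_pred1 q) ?vS /v ?qs ?ql // => r; rewrite /arrow_path pi eqxx /=.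
  by apply/andP/eqP => [[/eqP rs /eqP rl]|->]; [apply: qpath_inj; rewrite ?rs ?rl ?qs ?ql|rewrite qs ql !eqxx].
(* The sum of the trivial paths, the unit of the path algebra. *)
exists h, [ffun q => (plen q == 0%N)%:R]; rewrite hE.
rewrite -[LHS]sum_idem -[RHS]sum_idem; apply: eq_bigr => j _.
rewrite linear_sum; have [jD|jD] := boolP (j \in D).
  by rewrite big1 ?(Omega_idem0 _ CX) // => q _; rewrite linearZ /= (Omega_idem0 _ CX) // scaler0.
have [p [ps pl]] := qpath_trivial jD.
rewrite (bigD1 p) //= big1 => [|q qp].
  by rewrite addr0 linearZ /= ffunE pl scale1r /v pl ps pw0 idemK.
rewrite linearZ /= ffunE; case: eqP => ql; last by rewrite scale0r.
rewrite /v ql pw0 idem_idem; case: eqP => [jq|_]; last by rewrite scaler0.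
by case/eqP: qp; apply: qpath_inj; rewrite ?ps ?pl.
Qed.

(** m is sent to the functional p |-> [phi] (p m), with [phi] nonzero on the component of x at i;
    evaluation at the trivial path at i detects x. *)
Lemma dual_regular_cogenerates X (x : mspace X) : C X -> x != 0 ->
  exists h : hom X (dual_regular K (~: D)), h x != 0.
Proof.
move=> CX /nonzero_idem[i xi]; have [phi phi1] := functional_nonzero xi.
have iD : i \notin D by apply: contra xi => iD; rewrite (Omega_idem0 _ CX).
have [|||h hE] := @hom_ex_arrow K n X (dual_regular K (~: D))
  (fun m => [ffun p => phi (pw X (plen p) (idem X (psrc p) m))]).
- by move=> a y z; apply/ffunP => p; rewrite !ffunE !linearP.
- move=> j y; apply/ffunP => p; rewrite dreg_idemE !ffunE idem_idem.
  by case: eqP => [->|]; rewrite ?linear0.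
- move=> j y; apply/ffunP => p; rewrite [RHS]dreg_arrowE ffunE.
  rewrite -tot_idem -idem_tot idem_idem; case: eqP => [pj|pj]; last first.
    by rewrite !linear0 big1 // => q /and3P[/eqP].
  rewrite idem_tot -pwSr; have [jD|jD] := boolP (j \in D).
    rewrite (Omega_idem0 _ CX) // !linear0 big1 // => q /and3P[_ /eqP qj _].
    by have := psrc_mem q; rewrite qj jD.
  have [q [qs ql]] := qpath_prev pj jD.
  rewrite (big_pred1 q) ?ffunE ?qs ?ql // => r; rewrite /path_arrow pj eqxx /=.
  by apply/andP/eqP => [[/eqP rs /eqP rl]|->]; [apply: qpath_inj; rewrite ?rs ?rl ?qs ?ql|rewrite qs ql !eqxx].
exists h; have [p [ps pl]] := qpath_trivial iD.
apply/eqP => /ffunP/(_ p); rewrite hE !ffunE pl ps pw0 phi1 => /eqP.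
by rewrite oner_eq0.
Qed.

Lemma dsumC_iso M N : isomorphic (dsum M N) (dsum N M).
Proof.
apply: (@iso_of_cancel _ _ _ _ (hpair (hsnd M N) (hfst M N)) (hpair (hsnd N M) (hfst N M))) => x;
by rewrite !hpairE !hsndE !hfstE /= -pairE.
Qed.

Lemma dsum_zero_iso M : isomorphic M (dsum M (zeromod K n)).
Proof.
apply: (@iso_of_cancel _ _ _ _ (hinl M (zeromod K n)) (hfst M (zeromod K n))) => x; rewrite hinlE hfstE //.
by rewrite [RHS]pairE; congr pair; apply/rowP; case.
Qed.

Lemma in_add_inl M N : in_add (dsum M N) M.
Proof. by exists 1%N, N; exact: dsum_zero_iso. Qed.

Lemma in_add_inr M N : in_add (dsum M N) N.
Proof. by exists 1%N, M; exact: iso_trans (dsumC_iso N M) (dsum_zero_iso _). Qed.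

Lemma section_of_retraction X Y E (f : hom Y E) (g : hom E X) (r : hom E Y) :
  limg g = fullv -> limg f = lker g -> (forall y, r (f y) = y) ->
  exists s : hom X E, forall x, g (s x) = x.
Proof.
move=> lg fg rf; pose u := hadd (hid E) (hopp (hcomp f r)).
have uE e : u e = e - f (r e) by rewrite haddE hidE hoppE hcompE.
have [|s sE] := @factor_epi _ _ _ _ _ g u lg.
  by move=> e /eqP; rewrite -memv_ker -fg => /limgP[y ->]; rewrite uE rf subrr.
exists s => x; have [e <-] := limg_full lg x; rewrite sE uE linearB /=.
have -> : g (f (r e)) = 0 by apply/eqP; rewrite -memv_ker -fg mem_limg.
by rewrite subr0.
Qed.

Lemma cotilting_ex (T F : subcat K n) : torsion_pair C T F -> sincere_on (~: D) F ->
  exists U, cotilting (~: D) U /\ same_subcat F (Cogen U).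
Proof.
move=> tp sF; have FC X : F X -> C X by move=> /(torsionfreeP _ tp)[].
have [F0 [F1 [k [f0 [[[FF0 fac] FF1 kk lf0 lk] [ext0 ext1]]]]]] :=
  coresolution_ex dD tp sF dual_regular_Omega dual_regular_arrows_onto
    regular_Omega regular_arrows_into (fun X CX x => regular_generates x CX).
pose U := dsum F0 F1; have CU : C U by apply: Omega_dsum; exact: FC.
have FU : F U by exact: torsionfree_dsum tp CU FF0 FF1.
exists U; split.
  split=> //.
  - apply: (id_le1_all dD dual_regular_Omega dual_regular_arrows_onto) => x.
    exact: dual_regular_cogenerates CU.
  - move=> E f g CE /short_exact_elim[f' [g' [_ <- kf lg fg]]].
    have [h0 h0E] := ext0 _ _ _ f' g' (hfst F0 F1) FU CE kf lg fg.
    have [h1 h1E] := ext1 _ _ _ f' g' (hsnd F0 F1) FU CE kf lg fg.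
    have [|s sE] := @section_of_retraction _ _ _ f' g' (hpair h0 h1) lg fg.
      by move=> y; rewrite hpairE h0E h1E hfstE hsndE -pairE.
    by exists s; split; [exact: homP|apply/lfunP => x; rewrite comp_lfunE id_lfunE sE].
  exists F1, F0, k, f0; split; [exact: in_add_inl|exact: in_add_inr|exact: short_exact_intro].
move=> M; split=> [FM|[m [g [Hg kg]]]].
  have [|m [g kg]] := @cogen_intro _ _ M U; last first.
    by exists m, g; split=> //; exact: homP.
  (* Functionals into the injective cogenerator separate the elements of M, and since M is
     torsion-free they factor through F0. *)
  move=> x x0; have [h hx] := dual_regular_cogenerates (FC _ FM) x0.
  have [g gE] := fac M FM h; exists (hcomp (hinl F0 F1) g).
  rewrite hcompE hinlE; apply: contraNneq hx => -[gx].
  by rewrite -gE gx linear0.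
have FP : F (power m U).
  apply: subcat_power FU => [Z z0|A B FA FB]; first exact: (torsionfree_zero tp (Omega_zero z0) z0).
  by apply: (torsionfree_dsum tp _ FA FB); apply: Omega_dsum; exact: FC.
exact: (torsionfree_sub (f := Hom Hg) tp (@Omega_sub _ _ _) kg FP).
Qed.

End PathModules.

(** * Duality *)

Section Duality.
Variables (K : fieldType) (n : nat).
Implicit Types (M N X Y Z : cycmod K n) (i j c : 'I_n) (D : {set 'I_n}).

(* Transposition reverses the arrows; rev_ord identifies the reversed cyclic quiver
   with the original one. *)
Record dual_pairing M N (b : mspace M -> mspace N -> K) : Prop := DualPairing {
  pairing_linl : forall a x y z, b (a *: x + y) z = a * b x z + b y z;
  pairing_linr : forall a x y z, b z (a *: x + y) = a * b z x + b z y;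
  pairing_nondegl : forall x, (forall z, b x z = 0) -> x = 0;
  pairing_nondegr : forall z, (forall x, b x z = 0) -> z = 0;
  pairing_idem : forall i x z, b (idem M i x) z = b x (idem N (rev_ord i) z);
  pairing_tot : forall x z, b (tot M x) z = b x (tot N z)
}.

(** A symmetric relation rather than a functor: a module is a dual of each of its duals, so biduals
    need no identification. *)
Definition dual M N := exists b : mspace M -> mspace N -> K, dual_pairing b.

Lemma pairing_sym M N (b : mspace M -> mspace N -> K) :
  dual_pairing b -> dual_pairing (fun y x => b x y).
Proof.
by case=> bl br l0 r0 be bA; split=> // i x z; rewrite be rev_ordK.
Qed.

Lemma dual_sym M N : dual M N -> dual N M.
Proof. by move=> [b /pairing_sym H]; exists (fun y x => b x y). Qed.

Lemma ordS_rev i : ordS (rev_ord (ordS i)) = rev_ord i.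
Proof.
apply: val_inj => /=; have := ltn_ord i; rewrite leq_eqVlt => /orP[/eqP E|lt].
  have -> : (i.+1 %% n = 0)%N by rewrite E modnn.
  by rewrite subn1 prednK ?(leq_ltn_trans _ (ltn_ord i)) // modnn E subnn.
rewrite (modn_small lt) -subSn // subSS modn_small //.
by rewrite ltn_subrL /= (leq_ltn_trans _ (ltn_ord i)).
Qed.

Lemma dual_ex M : exists N, dual M N.
Proof.
pose V : vectType K := 'Hom(mspace M, K^o).
have lin (t : 'End(mspace M)) : linear (fun f : V => (f \o t)%VF : V).
  by move=> a f g; apply/lfunP => x; rewrite comp_lfunE !add_lfunE !scale_lfunE !comp_lfunE.
pose e i : 'End(V) := linfun (fun f : V => (f \o idem M (rev_ord i))%VF : V).
pose A : 'End(V) := linfun (fun f : V => (f \o tot M)%VF : V).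
have eE i (f : V) x : e i f x = f (idem M (rev_ord i) x) by rewrite linfun_linE // comp_lfunE.
have AE (f : V) x : A f x = f (tot M x) by rewrite linfun_linE // comp_lfunE.
have ee i j (f : V) : e i (e j f) = if i == j then e j f else 0.
  apply/lfunP => x; rewrite !eE idem_idem (inj_eq rev_ord_inj) eq_sym.
  by case: eqP => [->|_]; rewrite ?eE // zero_lfunE linear0.
have se (f : V) : \sum_i e i f = f.
  apply/lfunP => x; rewrite sum_lfunE -[in RHS](sum_idem x) linear_sum.
  by rewrite (reindex_inj rev_ord_inj); apply: eq_bigr => i _; rewrite eE rev_ordK.
have eA i (f : V) : e (ordS i) (A f) = A (e i f).
  by apply/lfunP => x; rewrite eE !AE eE -(ordS_rev i) idem_tot.
exists (tcyc ee se eA), (fun x (f : V) => (f : 'Hom(mspace M, K^o)) x); split.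
- by move=> a x y f; rewrite linearP.
- by move=> a f g x; rewrite add_lfunE scale_lfunE.
- move=> x H; apply/eqP/negPn/negP => /functional_nonzero[f f1].
  by have /eqP := H f; rewrite f1 oner_eq0.
- by move=> f H; apply/lfunP => x; rewrite zero_lfunE.
- by move=> i x f; rewrite eE rev_ordK.
- by move=> x f; rewrite tot_tcyc AE.
Qed.

Section Pairing.
Variables (M N : cycmod K n) (b : mspace M -> mspace N -> K).
Hypothesis bP : dual_pairing b.

Lemma pairing0l z : b 0 z = 0.
Proof. by rewrite -[0](subrr 0) -scaleN1r addrC (pairing_linl bP) mulN1r addNr. Qed.

Lemma pairing_lfun_ex : exists B : 'Hom(mspace N, 'Hom(mspace M, K^o)), forall z x, B z x = b x z.
Proof.
have l1 z : linear (fun x => b x z : K^o) by move=> a x y; rewrite (pairing_linl bP).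
have l2 : linear (fun z => linfun (fun x => b x z : K^o) : 'Hom(mspace M, K^o)).
  move=> a z w; apply/lfunP => x; rewrite add_lfunE scale_lfunE !linfun_linE //.
  by rewrite (pairing_linr bP).
by exists (linfun (fun z => linfun (fun x => b x z : K^o))) => z x; rewrite !linfun_linE.
Qed.

Lemma pairing_dim_le : (\dim {:mspace N} <= \dim {:mspace M})%N.
Proof.
have [B BE] := pairing_lfun_ex.
have <- : \dim {: 'Hom(mspace M, K^o)} = \dim {:mspace M} by rewrite !dimvf /dim /= muln1.
have <- : \dim (limg B) = \dim {:mspace N}; last by apply: dimvS; exact: subvf.
rewrite limg_dim_eq // lker0_intro ?capv0 // => z Bz.
by apply: (pairing_nondegr bP) => x; rewrite -BE Bz zero_lfunE.
Qed.

End Pairing.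

(** Nondegeneracy on both sides forces equal dimensions, so every functional on M is represented by
    an element of N. *)
Lemma pairing_rep M N (b : mspace M -> mspace N -> K) : dual_pairing b ->
  exists R : 'Hom(mspace M, K^o) -> mspace N, forall (phi : 'Hom(mspace M, K^o)) x, phi x = b x (R phi).
Proof.
move=> bP; have [B BE] := pairing_lfun_ex bP.
have lB : limg B = fullv.
  apply: lker_bij_dim.
    by apply: lker0_intro => z Bz; apply: (pairing_nondegr bP) => x; rewrite -BE Bz zero_lfunE.
  have := pairing_dim_le (pairing_sym bP).
  by rewrite !dimvf [X in _ -> (X <= _)%N]/dim /= muln1.
by exists (B^-1)%VF => phi x; rewrite -BE limg_lfunVK // lB memvf.
Qed.

Lemma pairing_injr M N (b : mspace M -> mspace N -> K) z w : dual_pairing b ->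
  (forall x, b x z = b x w) -> z = w.
Proof.
move=> bP H; apply/eqP; rewrite -subr_eq0; apply/eqP; apply: (pairing_nondegr bP) => x.
by rewrite -scaleN1r addrC (pairing_linr bP) H mulN1r addNr.
Qed.

Section Adjoint.
Variables (M M' N N' : cycmod K n).
Variables (b : mspace M -> mspace M' -> K) (c : mspace N -> mspace N' -> K).
Hypotheses (bP : dual_pairing b) (cP : dual_pairing c).

Lemma adjoint_ex (f : hom M N) : exists f' : hom N' M', forall x y, c (f x) y = b x (f' y).
Proof.
have [R RE] := pairing_rep bP; have [B BE] := pairing_lfun_ex cP.
pose g y := R (B y \o f)%VF.
have gE x y : b x (g y) = c (f x) y by rewrite -RE comp_lfunE BE.
have [|||h hE] := @hom_ex _ _ N' M' g.
- move=> a y z; apply: (pairing_injr bP) => x.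
  by rewrite (pairing_linr bP) !gE (pairing_linr cP).
- move=> i y; apply: (pairing_injr bP) => x; rewrite -(rev_ordK i) -(pairing_idem bP) !gE.
  by rewrite -(pairing_idem cP) hom_idem.
- move=> y; apply: (pairing_injr bP) => x.
  by rewrite -(pairing_tot bP) !gE -(pairing_tot cP) hom_tot.
by exists h => x y; rewrite hE gE.
Qed.

(** The image of the adjoint is the annihilator of the kernel: a functional vanishing on the kernel
    of f factors through f. *)
Lemma adjoint_limg (f : 'Hom(mspace M, mspace N)) (f' : mspace N' -> mspace M') z :
  (forall x y, c (f x) y = b x (f' y)) ->
  (forall x, f x = 0 -> b x z = 0) -> exists y, z = f' y.
Proof.
move=> fE H; have [B BE] := pairing_lfun_ex bP; have [R RE] := pairing_rep cP.
exists (R (B z \o f^-1)%VF); apply: (pairing_injr bP) => x.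
rewrite -fE -RE comp_lfunE -BE.
have : B z (x - (f^-1)%VF (f x)) = 0.
  by rewrite BE H // linearB /= limg_lfunVK ?mem_limg // subrr.
by rewrite linearB => /subr0_eq.
Qed.

Lemma adjoint_epi (f : hom M N) (f' : hom N' M') : (forall x y, c (f x) y = b x (f' y)) ->
  lker f = 0%VS -> limg f' = fullv.
Proof.
move=> fE kf; apply: limg_full_intro => z.
have [|y ->] := adjoint_limg (z := z) fE; last by exists y.
by move=> x fx; rewrite (_ : x = 0) ?(pairing0l bP) //; apply: (lker0_inj kf); rewrite fx linear0.
Qed.

Lemma adjoint_mono (f : hom M N) (f' : hom N' M') : (forall x y, c (f x) y = b x (f' y)) ->
  limg f = fullv -> lker f' = 0%VS.
Proof.
move=> fE lf; apply: hom_ker0 => y fy; apply: (pairing_nondegr cP) => z.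
have [x <-] := limg_full lf z.
by rewrite fE fy -(pairing0l (pairing_sym bP) x).
Qed.

End Adjoint.

Lemma adjoint_exact X Y Z X' Y' Z' (a : mspace X -> mspace X' -> K)
    (b : mspace Y -> mspace Y' -> K) (c : mspace Z -> mspace Z' -> K)
    (f : hom X Y) (g : hom Y Z) (f' : hom Y' X') (g' : hom Z' Y') :
  dual_pairing a -> dual_pairing b -> dual_pairing c ->
  (forall x y, b (f x) y = a x (f' y)) -> (forall x y, c (g x) y = b x (g' y)) ->
  limg f = lker g -> limg g' = lker f'.
Proof.
move=> aP bP cP fE gE fg; apply/vspaceP => y; rewrite memv_ker.
apply/idP/eqP => [/limgP[z ->]|fy].
  apply: (pairing_nondegr aP) => x; rewrite -fE -gE.
  have -> : g (f x) = 0 by apply/eqP; rewrite -memv_ker -fg mem_limg.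
  exact: pairing0l cP _.
have [|z ->] := adjoint_limg bP cP (z := y) gE; last exact: mem_limg.
move=> x /eqP; rewrite -memv_ker -fg => /limgP[w ->].
by rewrite fE fy (pairing0l (pairing_sym aP)).
Qed.

Lemma dual_unique M N N' : dual M N -> dual M N' -> isomorphic N N'.
Proof.
move=> [b bP] [c cP].
have [f fE] := adjoint_ex bP cP (hid M); have [g gE] := adjoint_ex cP bP (hid M).
apply: (@iso_of_cancel _ _ _ _ g f) => y.
  by apply: (pairing_injr bP) => x; rewrite -fE hidE -gE hidE.
by apply: (pairing_injr cP) => x; rewrite -gE hidE -fE hidE.
Qed.

Lemma dual_iso M M' N : isomorphic M M' -> dual M N -> dual M' N.
Proof.
move=> /iso_elim[f [g [fg gf]]] [b bP]; exists (fun x => b (g x)); split.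
- by move=> a x y z; rewrite linearP (pairing_linl bP).
- by move=> a x y z; rewrite (pairing_linr bP).
- by move=> x H; apply: (can_inj gf); rewrite linear0; exact: pairing_nondegl bP _ H.
- move=> z H; apply: (pairing_nondegr bP) => x; by rewrite -(fg x).
- by move=> i x z; rewrite hom_idem (pairing_idem bP).
- by move=> x z; rewrite hom_tot (pairing_tot bP).
Qed.

Lemma dual_dsum M M' N N' : dual M M' -> dual N N' -> dual (dsum M N) (dsum M' N').
Proof.
move=> [b bP] [c cP].
pose e (x : mspace (dsum M N)) (z : mspace (dsum M' N')) := b x.1 z.1 + c x.2 z.2.
exists e; split.
- by move=> a x y z; rewrite /e /= (pairing_linl bP) (pairing_linl cP) mulrDr addrACA.
- by move=> a x y z; rewrite /e /= (pairing_linr bP) (pairing_linr cP) mulrDr addrACA.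
- move=> x H; rewrite [LHS]pairE; congr pair.
    apply: (pairing_nondegl bP) => z; have := H (z, 0).
    by rewrite /e /= (pairing0l (pairing_sym cP)) addr0.
  apply: (pairing_nondegl cP) => z; have := H (0, z).
  by rewrite /e /= (pairing0l (pairing_sym bP)) add0r.
- move=> x H; rewrite [LHS]pairE; congr pair.
    apply: (pairing_nondegr bP) => z; have := H (z, 0).
    by rewrite /e /= (pairing0l cP) addr0.
  apply: (pairing_nondegr cP) => z; have := H (0, z).
  by rewrite /e /= (pairing0l bP) add0r.
- by move=> i x z; rewrite /e !dsum_idemE /= (pairing_idem bP) (pairing_idem cP).
- by move=> x z; rewrite /e !dsum_totE /= (pairing_tot bP) (pairing_tot cP).
Qed.

Lemma pairing_pw M N (b : mspace M -> mspace N -> K) : dual_pairing b ->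
  forall k x z, b (pw M k x) z = b x (pw N k z).
Proof. by move=> bP; elim=> [|k IH] x z; rewrite ?pw0 // pwS (pairing_tot bP) IH -pwSr. Qed.

Lemma dual_Ecat M N : dual M N -> Ecat M -> Ecat N.
Proof.
move=> [b bP] /Ecat_pw[k H]; apply/Ecat_pw; exists k => z.
by apply: (pairing_nondegr bP) => x; rewrite -(pairing_pw bP) H (pairing0l bP).
Qed.

Definition revset D : {set 'I_n} := [set i | rev_ord i \in D].

Lemma revsetK D : revset (revset D) = D.
Proof. by apply/setP => i; rewrite !inE rev_ordK. Qed.

Lemma dual_Omega D M N : dual M N -> Omega_mod (~: D) M -> Omega_mod (~: revset D) N.
Proof.
move=> [b bP] H; apply: Omega_intro => i z; rewrite !inE negbK => iD.
apply: (pairing_nondegr bP) => x; rewrite -(rev_ordK i) -(pairing_idem bP).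
by rewrite (Omega_idem0 _ H) // (pairing0l bP).
Qed.

Lemma dual_Coray D M N : dual M N -> Coray D M -> Ray (revset D) N.
Proof.
move=> MN /CorayP[EM H]; apply/RayP; split; first exact: dual_Ecat MN EM.
have [b bP] := MN; move=> i z; rewrite inE => iD z0.
apply: (pairing_nondegr bP) => x; rewrite -(rev_ordK i) -(pairing_idem bP).
rewrite -[idem M _ x]idemK (pairing_idem bP) rev_ordK.
by have [w ->] := H _ x iD; rewrite (pairing_tot bP) z0 (pairing0l (pairing_sym bP)).
Qed.

Lemma dual_Ray D M N : dual M N -> Ray D M -> Coray (revset D) N.
Proof.
move=> MN /RayP[EM H]; apply/CorayP; split; first exact: dual_Ecat MN EM.
have [b bP] := MN; move=> i z; rewrite inE => iD.
apply: (adjoint_limg bP bP (f := tot M) (pairing_tot bP)) => x x0.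
by rewrite -(rev_ordK i) -(pairing_idem bP) H ?(pairing0l bP) // -idem_tot x0 linear0.
Qed.

Lemma dual_arrows_into D M N : dual M N -> arrows_into D M -> arrows_onto (revset D) N.
Proof.
move=> [b bP] H i z; rewrite inE => iD; set j := rev_ord (ordS i).
have jS : ordS j = rev_ord i by exact: ordS_rev.
have [||w wE] := @adjoint_limg _ _ _ _ b b bP bP (tot M \o idem M j)%VF (fun w => tot N (idem N i w))
   (idem N (ordS i) z).
- move=> x y; rewrite comp_lfunE (pairing_tot bP) (pairing_idem bP).
  by rewrite /j rev_ordK idem_tot.
- move=> x; rewrite comp_lfunE => x0.
  by rewrite -(rev_ordK (ordS i)) -(pairing_idem bP) H ?jS // (pairing0l bP).
by exists w.
Qed.

Definition dual_subcat (A : subcat K n) : subcat K n := fun N => exists M, A M /\ dual M N.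

Lemma dual_sincere D A : sincere_on (~: D) A -> sincere_on (~: revset D) (dual_subcat A).
Proof.
move=> H i; rewrite !inE => iD; have [|Y [AY [y yi]]] := H (rev_ord i); first by rewrite inE.
have [Y' YY'] := dual_ex Y; have [b bP] := YY'.
exists Y'; split; first by exists Y.
apply: NNPP => no; case/eqP: yi; apply: (pairing_nondegl bP) => z.
rewrite (pairing_idem bP) rev_ordK.
have -> : idem Y' i z = 0 by apply/eqP/negPn/negP => h; apply: no; exists z.
exact: pairing0l (pairing_sym bP) _.
Qed.

Lemma torsion_pair_dual (C T F : subcat K n) : torsion_pair C T F ->
  torsion_pair (dual_subcat C) (dual_subcat F) (dual_subcat T).
Proof.
move=> tp; have [[TC FC] [Ti Fi] TF _] := tp; split.
- by split=> N [M [AM MN]]; exists M; split=> //; [exact: FC|exact: TC].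
- split=> X Y XY [M [AM MX]]; exists M; split=> //; apply: dual_sym;
  exact: dual_iso XY (dual_sym MX).
- move=> X' Y' [X [FX [b bP]]] [Y [TY [c cP]]]; apply/hom_zeroP => f' x'.
  have [f fE] := adjoint_ex (pairing_sym bP) (pairing_sym cP) f'.
  apply: (pairing_nondegr cP) => y; rewrite fE.
  by rewrite (proj1 (hom_zeroP _ _) (TF _ _ TY FX)) (pairing0l bP).
move=> X' [X [CX [b bP]]].
have [XT [XF [f [g [TT FF kf lg fg]]]]] := tp_seq tp CX.
have [XT' TT'] := dual_ex XT; have [XF' FF'] := dual_ex XF.
have [c cP] := TT'; have [e eP] := FF'.
have [f' fE] := adjoint_ex cP bP f; have [g' gE] := adjoint_ex bP eP g.
exists XF', XT', g', f'; split; [by exists XF|by exists XT|].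
apply: short_exact_intro; [exact: adjoint_mono gE lg|exact: adjoint_epi fE kf|].
exact: adjoint_exact cP bP eP fE gE fg.
Qed.

Lemma dual_Omega_same D : same_subcat (dual_subcat (Omega_mod (~: D))) (@Omega_mod K n (~: revset D)).
Proof.
move=> N; split=> [[M [HM MN]]|HN]; first exact: dual_Omega MN HM.
have [M NM] := dual_ex N; exists M; split; last exact: dual_sym.
by have := dual_Omega NM HN; rewrite revsetK.
Qed.

Lemma same_refl (A : subcat K n) : same_subcat A A. Proof. by []. Qed.

Lemma dual_subcatK (A : subcat K n) : (forall X Y, isomorphic X Y -> A X -> A Y) ->
  same_subcat (dual_subcat (dual_subcat A)) A.
Proof.
move=> Ai N; split=> [[M [[L [AL LM]] MN]]|AN].
  exact: Ai (dual_unique (dual_sym LM) MN) AL.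
have [M NM] := dual_ex N; exists M; split; last exact: dual_sym.
by exists N.
Qed.

Theorem ray_torsion_pair D (T F : subcat K n) : D != set0 ->
  torsion_pair (Omega_mod (~: D)) T F -> sincere_on (~: D) T ->
  torsion_pair (@Ecat K n) T (oplus F (Ray D)).
Proof.
move=> /set0Pn[d dD] tp sT; have [_ [Ti Fi] _ _] := tp.
have tp' := torsion_pair_same (@dual_Omega_same D) (@same_refl _) (@same_refl _) (torsion_pair_dual tp).
have D'0 : revset D != set0 by apply/set0Pn; exists (rev_ord d); rewrite inE rev_ordK.
have := torsion_pair_dual (coray_torsion_pair D'0 tp' (dual_sincere sT)).
apply: torsion_pair_same; last 2 first.
- exact: dual_subcatK.
- move=> N; split=> [[M [[A [B [CA [G [FG GB]] MAB]]] MN]]|[G [R [FG RR NGR]]]].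
    have [A' AA'] := dual_ex A; exists G, A'; split=> //.
      by have := dual_Coray AA' CA; rewrite revsetK.
    apply: iso_trans (dsumC_iso A' G).
    apply: dual_unique MN _; apply: dual_iso (iso_sym MAB) _.
    exact: dual_dsum AA' (dual_sym GB).
  have [R' RR'] := dual_ex R; have [G' GG'] := dual_ex G.
  exists (dsum R' G'); split.
    exists R', G'; split; [exact: dual_Ray RR' RR|by exists G|exact: iso_refl].
  apply: dual_sym; apply: dual_iso (dual_dsum RR' GG').
  exact: iso_trans (dsumC_iso R G) (iso_sym NGR).
- move=> N; split=> [[M [EM MN]]|EN]; first exact: dual_Ecat MN EM.
  have [M NM] := dual_ex N; exists M; split; last exact: dual_sym.
  exact: dual_Ecat NM EN.
Qed.

(** * Tilting modules by transposition *)

Section Tilting.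
Variables (D : {set 'I_n}) (d : 'I_n).
Hypothesis dD : d \in D.
Local Notation C := (@Omega_mod K n (~: D)).

Let dD' : rev_ord d \in revset D. Proof. by rewrite inE rev_ordK. Qed.

Lemma arrows_into_projective P : C P -> arrows_into D P -> projective_in C P.
Proof.
move=> CP iP; split=> // X Y g0 h0 CX CY [Hg lg] Hh.
pose g : hom X Y := Hom Hg; pose h : hom P Y := Hom Hh.
have [P' PP'] := dual_ex P; have [X' XX'] := dual_ex X; have [Y' YY'] := dual_ex Y.
have [a aP] := PP'; have [b bP] := XX'; have [c cP] := YY'.
have [g' gE] := adjoint_ex bP cP g; have [h' hE] := adjoint_ex aP cP h.
have [k kE] := arrows_onto_extend dD' h' (dual_Omega XX' CX) (dual_Omega PP' CP)
  (dual_arrows_into PP' iP) (adjoint_mono bP cP gE lg).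
have [k' k'E] := adjoint_ex (pairing_sym bP) (pairing_sym aP) k.
exists k'; split; first exact: homP.
apply/lfunP => p; rewrite comp_lfunE.
apply: (pairing_injr (pairing_sym cP)) => y.
by rewrite -[g0]/(hfun g) -[h0]/(hfun h) gE -k'E kE hE.
Qed.

Lemma arrows_into_sub M N (f : hom M N) : lker f = 0%VS -> arrows_into D N -> arrows_into D M.
Proof.
move=> kf iN i x iD x0; apply: (lker0_inj kf); rewrite hom_idem iN ?linear0 //.
by rewrite -hom_idem -hom_tot x0 linear0.
Qed.

Lemma arrows_into_dsum M N : arrows_into D M -> arrows_into D N -> arrows_into D (dsum M N).
Proof.
move=> iM iN i x iD; rewrite dsum_idemE dsum_totE /= => -[x1 x2].
by rewrite (iM _ _ iD x1) (iN _ _ iD x2).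
Qed.

Lemma pd_le1_all X : C X -> pd_le1 C X.
Proof.
move=> CX; have [|m [g lg]] := @gen_intro K n (regular K (~: D)) X.
  by move=> x; exact: (regular_generates dD x CX).
set P := power m _ in g lg.
have CP : C P.
  by rewrite /P; apply: (@subcat_power K n C _ m _ _ (@regular_Omega K n D)); [exact: Omega_zero|exact: Omega_dsum].
have iP : arrows_into D P.
  rewrite /P; apply: (@subcat_power K n (@arrows_into K n D) _ m _ _ (@regular_arrows_into K n D d dD)); [|exact: arrows_into_dsum].
  by move=> Z z0 i x _ _; exact: z0.
have [S [f [kf lf]]] := sub_ex (submodule_lker g).
exists S, P, f, g; split; last exact: short_exact_intro.
  by apply: arrows_into_projective; [exact: Omega_sub kf CP|exact: arrows_into_sub kf iP].
exact: arrows_into_projective.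
Qed.

(** The approximation argument is applied to the dual pair with a dual of the regular module as I.
    Transposing the resulting sequence gives 0 -> [regular] -> T0 -> T1 -> 0 directly. *)
Lemma tilting_ex (T F : subcat K n) : torsion_pair C T F -> sincere_on (~: D) T ->
  exists X, tilting (~: D) X /\ same_subcat T (Gen X).
Proof.
move=> tp sT; have TC X : T X -> C X by move=> /(torsionP _ tp)[].
have tp' := torsion_pair_same (@dual_Omega_same D) (@same_refl _) (@same_refl _) (torsion_pair_dual tp).
have [I' RI] := dual_ex (regular K (~: D)); have [a aP] := RI.
have [F0 [F1 [k [f0 [[[[T0 [TT0 TF0]] fac] [T1 [TT1 TF1]] kk lf0 lk] [ext0 ext1]]]]]] :=
  coresolution_ex dD' tp' (dual_sincere sT) (dual_Omega RI (@regular_Omega K n D))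
    (dual_arrows_into RI (@regular_arrows_into K n D d dD))
    (@regular_Omega K n (revset D)) (@regular_arrows_into K n _ _ dD') (fun X CX x => regular_generates dD' x CX).
have [b0 b0P] := TF0; have [b1 b1P] := TF1.
have [u uE] := adjoint_ex (pairing_sym b0P) (pairing_sym aP) f0.
have [v vE] := adjoint_ex (pairing_sym b1P) (pairing_sym b0P) k.
pose X := dsum T0 T1; have CX : C X by apply: Omega_dsum; exact: TC.
have TX : T X by exact: torsion_dsum tp CX TT0 TT1.
exists X; split.
  split=> //; first exact: pd_le1_all.
    move=> E f g CE /short_exact_elim[f' [g' [_ <- kf lg fg]]].
    have [X' XX'] := dual_ex X; have [E' EE'] := dual_ex E.
    have [c cP] := XX'; have [e eP] := EE'.
    have [fd fdE] := adjoint_ex cP eP f'; have [gd gdE] := adjoint_ex eP cP g'.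
    (* Transposition turns lifting h along g' into extending its adjoint along the adjoint of g',
       which [extends_to] provides. *)
    have lift V V' (b : mspace V -> mspace V' -> K) (h : hom V X) : dual_pairing b ->
        extends_to (revset D) (dual_subcat T) V' -> exists h' : hom V E, forall x, g' (h' x) = h x.
      move=> bP ext; have [hd hdE] := adjoint_ex bP cP h.
      have [|w wE] := ext _ _ _ gd fd hd _ (dual_Omega EE' CE) (adjoint_mono eP cP gdE lg)
        (adjoint_epi cP eP fdE kf) (adjoint_exact cP eP cP fdE gdE fg); first by exists X.
      have [w' w'E] := adjoint_ex (pairing_sym eP) (pairing_sym bP) w.
      exists w' => x; apply: (pairing_injr (pairing_sym cP)) => y.
      by rewrite gdE -w'E wE hdE.
    have [s0 s0E] := lift _ _ _ (hinl T0 T1) b0P ext0.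
    have [s1 s1E] := lift _ _ _ (hinr T0 T1) b1P ext1.
    exists (hcopair s0 s1); split; first exact: homP.
    apply/lfunP => x; rewrite comp_lfunE id_lfunE hcopairE linearD /= s0E s1E hinlE hinrE.
    by rewrite [RHS]pairE; congr pair; rewrite /= ?addr0 ?add0r.
  exists T0, T1, u, v; split; [exact: in_add_inl|exact: in_add_inr|].
  apply: short_exact_intro.
  - exact: (adjoint_mono (pairing_sym b0P) (pairing_sym aP) uE lf0).
  - exact: (adjoint_epi (pairing_sym b1P) (pairing_sym b0P) vE kk).
  - exact: (adjoint_exact (pairing_sym b1P) (pairing_sym b0P) (pairing_sym aP) vE uE lk).
move=> M; split=> [TM|[m [g [Hg lg]]]].
  have [|m [g lg]] := @gen_intro _ _ X M; last first.
    by exists m, g; split=> //; exact: homP.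
  move=> y; have [h [p hp]] := regular_generates dD y (TC _ TM).
  have [M' MM'] := dual_ex M; have [c cP] := MM'.
  have [h' h'E] := adjoint_ex aP cP h.
  have [|g gE] := fac M' _ h'; first by exists M.
  have [g' g'E] := adjoint_ex (pairing_sym cP) (pairing_sym b0P) g.
  exists (hcomp g' (hfst T0 T1)), (u p, 0); rewrite hcompE hfstE /= -hp.
  apply: (pairing_injr (pairing_sym cP)) => z.
  by rewrite -g'E -uE gE h'E.
have TP : T (power m X).
  apply: subcat_power TX => [Z z0|A B TA TB].
    by apply/(torsionP _ tp); split=> [|Y FY]; [exact: Omega_zero|apply/hom_zeroP => f x; rewrite (z0 x) linear0].
  by apply: (torsion_dsum tp _ TA TB); apply: Omega_dsum; exact: TC.
exact: (torsion_quot (f := Hom Hg) tp (@Omega_quot _ _ _) lg TP).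
Qed.

End Tilting.
End Duality.

(** * The classification *)

Section Uniserial.
Variables (K : fieldType) (n : nat) (c : 'I_n) (l : nat).
Let V : vectType K := {ffun 'I_l -> K^o}.

(** Coordinate model of the uniserial module of length l with top at c: the basis vector k sits at
    [sh k c], and [uni_tot] moves it to k + 1, or to 0 at the end. *)
Definition uni_idem i : 'End(V) :=
  linfun (fun f : V => [ffun k : 'I_l => if sh k c == i then f k else 0] : V).
Definition uni_tot : 'End(V) :=
  linfun (fun f : V => [ffun k : 'I_l => \sum_(j < l | j.+1 == k) f j] : V).

Lemma uni_idemE i (f : V) k : uni_idem i f k = if sh k c == i then f k else 0.
Proof.
rewrite linfun_linE ?ffunE // => a x y; apply/ffunP => j; rewrite !ffunE.
by case: ifP; rewrite ?scaler0 ?addr0.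
Qed.

Lemma uni_totE (f : V) k : uni_tot f k = \sum_(j < l | j.+1 == k) f j.
Proof.
rewrite linfun_linE ?ffunE // => a x y; apply/ffunP => j.
rewrite !ffunE scaler_sumr -big_split; apply: eq_bigr => m _; by rewrite !ffunE.
Qed.

Fact uni_idem_idem i j (f : V) : uni_idem i (uni_idem j f) = if i == j then uni_idem j f else 0.
Proof.
apply/ffunP => k; rewrite uni_idemE (fun_if (fun g : V => g k)) ffunE uni_idemE.
case: (eqVneq (sh k c) i) => [->|ki]; first by case: (i == j).
by case: (eqVneq i j) => [<-|//]; rewrite (negPf ki).
Qed.

Fact uni_sum_idem (f : V) : \sum_i uni_idem i f = f.
Proof.
apply/ffunP => k; rewrite sum_ffunE (bigD1 (sh k c)) //= big1 ?addr0 ?uni_idemE ?eqxx // => i ik.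
by rewrite uni_idemE eq_sym (negPf ik).
Qed.

Fact uni_idem_tot i (f : V) : uni_idem (ordS i) (uni_tot f) = uni_tot (uni_idem i f).
Proof.
apply/ffunP => k; rewrite uni_idemE !uni_totE.
case: ifP => ki; [apply: eq_bigr|rewrite big1 //] => j /eqP jk; rewrite uni_idemE.
  by move: ki; rewrite -jk shS (inj_eq (@ordS_inj n)) => ->.
by move: ki; rewrite -jk shS (inj_eq (@ordS_inj n)) => ->.
Qed.

Definition uniserial : cycmod K n := tcyc uni_idem_idem uni_sum_idem uni_idem_tot.

Definition uni_gen (k : 'I_l) : mspace uniserial := [ffun j => (j == k)%:R] : V.

Lemma uni_pw_low m (f : mspace uniserial) (k : 'I_l) : (k < m)%N -> (pw uniserial m f : V) k = 0.
Proof.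
elim: m k => [//|m IH] k km; rewrite pwS tot_tcyc uni_totE big1 // => j /eqP jk.
by apply: IH; rewrite -ltnS jk.
Qed.

Lemma uniserial_Ecat : Ecat uniserial.
Proof.
apply/Ecat_pw; exists l => f; apply/ffunP => k.
by rewrite uni_pw_low ?ffunE.
Qed.

Lemma uni_pw_gen (k0 k : 'I_l) : val k0 = 0%N -> (pw uniserial k (uni_gen k0) : V) k = 1.
Proof.
move=> k00; case: k => m; elim: m => [|m IH] lm.
  by rewrite pw0 ffunE (_ : _ == k0) //; apply/eqP/val_inj.
rewrite pwS tot_tcyc uni_totE (big_pred1 (Ordinal (ltnW lm))) => [|j]; first exact: IH.
by rewrite /= -val_eqE /= eqSS.
Qed.

Lemma uniserial_Ray (D : {set 'I_n}) : (forall k : 'I_l, k.+1 = l -> sh k c \in D) -> Ray D uniserial.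
Proof.
move=> H; apply/RayP; split; first exact: uniserial_Ecat.
move=> i f iD f0; apply/ffunP => k; rewrite uni_idemE ffunE; case: eqP => // ki.
have kl : (k.+1 < l)%N.
  rewrite ltn_neqAle ltn_ord andbT; apply/eqP => /H.
  by rewrite ki (negPf iD).
have := uni_totE (uni_idem i f) (Ordinal kl).
have -> : uni_tot (uni_idem i f) = 0 by rewrite -f0 tot_tcyc.
rewrite ffunE => /esym.
rewrite (big_pred1 k) => [|j]; last by rewrite /= eqSS.
by rewrite uni_idemE ki eqxx.
Qed.

End Uniserial.

Section Classification.
Variables (K : fieldType) (n : nat).
Implicit Types (M N X Y Z : cycmod K n) (i j c : 'I_n) (D : {set 'I_n}) (T F C : subcat K n).

(** If F meets every vertex, torsion modules have Loewy length less than n: a surviving path of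
    length L >= n - 1 from c could be mapped onto a nonzero element at c of a torsion-free
    module. *)
Lemma no_long_torsion T F X (x : mspace X) : torsion_pair (@Ecat K n) T F ->
  sincere_on (~: set0) F -> T X -> pw X n.-1 x = 0.
Proof.
move=> tp sF TX; have [[TC FC] _ TF _] := tp.
apply/eqP/negPn/negP => /nonzero_idem[b].
move=> /(longest_path_functional (TC _ TX))[phi [L [c [m [nL _ mc phim phiL]]]]].
have n0 : (0 < n)%N := leq_ltn_trans (leq0n _) (ltn_ord c).
have [|Y [FY [y0 yc0]]] := sF c; first by rewrite !inE.
have [s Hs] := proj1 (Ecat_pw _) (FC _ FY).
(* Full turns return to c, so after the last nonzero one the element y is still at c and is killed
   by one more turn. *)
have [||q [qy qmax]] := @ex_greatest (fun q => pw Y (q * n) (idem Y c y0) != 0) s.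
- by exists 0%N; rewrite mul0n pw0.
- move=> q; apply: contraR; rewrite -ltnNge => sq.
  by rewrite (@pw_le _ _ _ s) ?Hs //; apply: leq_trans (ltnW sq) (leq_pmulr _ n0).
set y := pw Y _ _ in qy.
have yc : idem Y c y = y.
  have /eqP sc : sh (q * n) c == c by rewrite sh_eq dvdn_mull.
  by rewrite /y -{1}sc -pw_idem idemK.
have yn : pw Y n y = 0.
  apply/eqP/negPn/negP; rewrite -pwD -mulSn => /qmax.
  by rewrite ltnn.
have yL : pw Y L.+1 y = 0 by apply: pw_le yn; rewrite -(prednK n0) ltnS.
have := proj1 (hom_zeroP _ _) (TF _ _ TX FY) (path_hom yc yL phiL) m.
rewrite path_hom_src // => /eqP.
by rewrite scaler_eq0 (negPf phim) (negPf qy).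
Qed.

(** The torsion part of X is killed by paths of length n - 1, and so is the torsion-free part, by
    duality. Hence X is killed by paths of length 2 (n - 1), although its length is one more than
    that. *)
Lemma not_both_sincere T F : (0 < n)%N -> torsion_pair (@Ecat K n) T F ->
  sincere_on (~: set0) T -> sincere_on (~: set0) F -> False.
Proof.
move=> n0 tp sT sF; pose l := (n.-1 + n.-1).+1.
pose X := uniserial K (Ordinal n0) l.
have [XT [XF [f [g [TT FF kf lg fg]]]]] := tp_seq tp (uniserial_Ecat K (Ordinal n0) l).
have rs0 : revset set0 = set0 :> {set 'I_n} by apply/setP => i; rewrite !inE.
have EE : same_subcat (dual_subcat (@Ecat K n)) (@Ecat K n).
  move=> N; split=> [[M [EM MN]]|EN]; first exact: dual_Ecat MN EM.
  have [M NM] := dual_ex N; exists M; split; last exact: dual_sym.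
  exact: dual_Ecat NM EN.
have tp' := torsion_pair_same EE (@same_refl _ _ _) (@same_refl _ _ _) (torsion_pair_dual tp).
have sT' := dual_sincere sT; rewrite rs0 in sT'.
have HF y : pw XF n.-1 y = 0.
  have [Z FZ] := dual_ex XF; have [b bP] := FZ.
  apply: (pairing_nondegl bP) => z; rewrite (pairing_pw bP).
  by rewrite (no_long_torsion z tp' sT') ?(pairing0l (pairing_sym bP)) //; exists XF.
have zero (x : mspace X) : pw X (n.-1 + n.-1) x = 0.
  have : pw X n.-1 x \in limg f by rewrite fg memv_ker hom_pw HF.
  rewrite pwD => /limgP[u ->].
  by rewrite -hom_pw (no_long_torsion u tp sF TT) linear0.
have := @uni_pw_gen K n (Ordinal n0) l ord0 ord_max erefl.
by rewrite zero ffunE => /eqP; rewrite eq_sym oner_eq0.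
Qed.

Lemma torsion_pair_restrict C C' T F : torsion_pair C T F ->
  (forall M, C' M -> C M) -> sub_closed C' -> quot_closed C' ->
  torsion_pair C' (fun M => T M /\ C' M) (fun M => F M /\ C' M).
Proof.
move=> tp CC sC qC; have [_ [Ti Fi] TF _] := tp.
have Ci X Y : isomorphic X Y -> C' X -> C' Y.
  move=> /iso_elim[f [g [fg gf]]]; apply: (sC _ _ g).
  by apply/eqP/lker0P; exact: can_inj gf.
split.
- by split=> X [].
- by split=> X Y XY [HX CX]; split; [exact: Ti XY HX|exact: Ci XY CX|exact: Fi XY HX|exact: Ci XY CX].
- by move=> X Y [TX _] [FY _]; exact: TF.
move=> X CX; have [XT [XF [f [g [TT FF kf lg fg]]]]] := tp_seq tp (CC _ CX).
exists XT, XF, f, g; split; last exact: short_exact_intro.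
  by split=> //; exact: (sC _ _ f).
by split=> //; exact: (qC _ _ g).
Qed.

Lemma torsion_unique C T F T' F' : torsion_pair C T F -> torsion_pair C T' F' ->
  same_subcat F F' -> same_subcat T T'.
Proof.
move=> tp tp' FF M; split=> [/(torsionP _ tp)|/(torsionP _ tp')] [CM H].
  by apply/(torsionP _ tp'); split=> // Y /FF; exact: H.
by apply/(torsionP _ tp); split=> // Y /FF; exact: H.
Qed.

Lemma torsionfree_unique C T F T' F' : torsion_pair C T F -> torsion_pair C T' F' ->
  same_subcat T T' -> same_subcat F F'.
Proof.
move=> tp tp' TT M; split=> [/(torsionfreeP _ tp)|/(torsionfreeP _ tp')] [CM H].
  by apply/(torsionfreeP _ tp'); split=> // Y /TT; exact: H.
by apply/(torsionfreeP _ tp); split=> // Y /TT; exact: H.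
Qed.

Lemma support_ex (A : subcat K n) : exists D,
  sincere_on (~: D) A /\ forall Y, A Y -> Omega_mod (~: D) Y.
Proof.
pose P i := exists Y, A Y /\ exists y, idem Y i y != 0.
have [b bP] : exists b : 'I_n -> bool, forall i, b i <-> P i.
  apply: (fin_all_exists (P := fun i (b : bool) => b <-> P i)) => i.
  by have [Pi|nPi] := classic (P i); [exists true|exists false].
exists [set i | ~~ b i]; split=> [i|Y AY].
  by rewrite !inE negbK => /bP.
apply: Omega_intro => i y; rewrite !inE negbK => bi.
by apply/eqP/negPn/negP => h; case/negP: bi; apply/bP; exists Y; split=> //; exists y.
Qed.

Lemma support_sub D1 D2 (A : subcat K n) : sincere_on (~: D1) A ->
  (forall Y, A Y -> Omega_mod (~: D2) Y) -> D2 \subset D1.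
Proof.
move=> sA AO; apply/subsetP => i iD; apply/negPn/negP => iD1.
have [|Y [AY [y]]] := sA i; first by rewrite inE.
by rewrite (Omega_idem0 _ (AO _ AY)) // eqxx.
Qed.

Lemma support_unique D1 D2 (A : subcat K n) : sincere_on (~: D1) A -> sincere_on (~: D2) A ->
  (forall Y, A Y -> Omega_mod (~: D1) Y) -> (forall Y, A Y -> Omega_mod (~: D2) Y) -> D1 = D2.
Proof.
by move=> s1 s2 o1 o2; apply/eqP; rewrite eqEsubset (support_sub s1 o2) (support_sub s2 o1).
Qed.

Lemma in_add_Omega (O : {set 'I_n}) X Y : in_add X Y -> Omega_mod O X -> Omega_mod O Y.
Proof.
move=> [m [Z /iso_elim[f [g [fg gf]]]]] CX.
have CP : Omega_mod O (power m X).
  apply: (@subcat_power K n (Omega_mod O) X m _ _ CX); last exact: Omega_dsum.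
  by move=> W w0; apply: Omega_intro => *; exact: w0.
apply: (@Omega_sub _ _ O _ _ (hcomp f (hinl Y Z))) CP.
apply: hom_ker0 => y; rewrite hcompE => fy.
have : hinl Y Z y = 0 by apply: (can_inj fg); rewrite fy linear0.
by rewrite hinlE => -[].
Qed.

(** If U vanished at i, so would U0 in add U and its quotient [dual_regular]; but the trivial path
    at i gives a nonzero element there. *)
Lemma cotilting_sincere D d (U : cycmod K n) : d \in D -> cotilting (~: D) U -> forall i, i \notin D ->
  exists y, idem U i y != 0.
Proof.
move=> dD [_ _ _ [U1 [U0 [f [g [aU0 _ [_ [Hg lg] _]]]]]]] i iD.
apply: NNPP => no.
have U0i : Omega_mod (~: [set i]) U.
  apply: Omega_intro => j y; rewrite !inE negbK => /eqP ->.
  by apply/eqP/negPn/negP => h; apply: no; exists y.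
have CR := Omega_quot (f := Hom Hg) lg (in_add_Omega aU0 U0i).
pose one : {ffun qpath (~: D) -> K^o} := [ffun=> 1].
have [p [ps _]] := qpath_trivial dD iD.
have /ffunP/(_ p)/eqP : idem (dual_regular K (~: D)) i one = 0 by rewrite (Omega_idem _ CR) // !inE eqxx.
by rewrite [X in X == _]dreg_idemE ps eqxx !ffunE oner_eq0.
Qed.

Lemma tilting_sincere D d X : d \in D -> tilting (~: D) X -> forall i, i \notin D ->
  exists y, idem X i y != 0.
Proof.
move=> dD [_ _ _ [T0 [T1 [f [g [aT0 _ [[Hf kf] _ _]]]]]]] i iD.
apply: NNPP => no.
have X0i : Omega_mod (~: [set i]) X.
  apply: Omega_intro => j y; rewrite !inE negbK => /eqP ->.
  by apply/eqP/negPn/negP => h; apply: no; exists y.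
have CR := Omega_sub (f := Hom Hf) kf (in_add_Omega aT0 X0i).
pose one : {ffun qpath (~: D) -> K^o} := [ffun=> 1].
have [p [ps pl]] := qpath_trivial dD iD.
have /ffunP/(_ p)/eqP : idem (regular K (~: D)) i one = 0 by rewrite (Omega_idem _ CR) // !inE eqxx.
by rewrite [X in X == _]reg_idemE /ptgt pl /= ps eqxx !ffunE oner_eq0.
Qed.

Lemma Cogen_self X : Cogen X X.
Proof.
exists 1%N, (hinl X (zeromod K n)); split; first exact: homP.
by apply: hom_ker0 => x; rewrite hinlE => -[].
Qed.

Lemma Gen_self X : Gen X X.
Proof.
exists 1%N, (hfst X (zeromod K n)); split; first exact: homP.
by apply: limg_full_intro => x; exists (x, 0); rewrite hfstE.
Qed.

Lemma cotilting_datum_sincere D T F : cotilting_datum D T F -> sincere_on (~: D) F.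
Proof.
move=> [/set0Pn[d dD] _ [U [cU FU]]] i; rewrite inE => iD.
by exists U; split; [apply/FU; exact: Cogen_self|exact: cotilting_sincere dD cU i iD].
Qed.

Lemma tilting_datum_sincere D T F : tilting_datum D T F -> sincere_on (~: D) T.
Proof.
move=> [/set0Pn[d dD] _ [U [cU FU]]] i; rewrite inE => iD.
by exists U; split; [apply/FU; exact: Gen_self|exact: tilting_sincere dD cU i iD].
Qed.

Lemma cotilting_datum_tp D T F : cotilting_datum D T F ->
  torsion_pair (@Ecat K n) (oplus (Coray D) T) F.
Proof. by move=> H; have [D0 tp _] := H; apply: coray_torsion_pair (cotilting_datum_sincere H). Qed.

Lemma tilting_datum_tp D T F : tilting_datum D T F ->
  torsion_pair (@Ecat K n) T (oplus F (Ray D)).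
Proof. by move=> H; have [D0 tp _] := H; apply: ray_torsion_pair (tilting_datum_sincere H). Qed.

(** The vertex set is recovered as the complement of the support of F1, which a cotilting module in
    F1 makes exact. *)
Lemma cotilting_datum_unique D1 D2 T1 F1 T2 F2 :
  cotilting_datum D1 T1 F1 -> cotilting_datum D2 T2 F2 -> same_subcat F1 F2 ->
  D1 = D2 /\ same_subcat T1 T2.
Proof.
move=> H1 H2 FF; have [_ tp1 _] := H1; have [_ tp2 _] := H2.
have E : D1 = D2.
  apply: (@support_unique _ _ F1 (cotilting_datum_sincere H1)).
  - by move=> i /(cotilting_datum_sincere H2)[Y [/FF FY]]; exists Y.
  - by move=> Y /(torsionfreeP _ tp1)[].
  - by move=> Y /FF/(torsionfreeP _ tp2)[].
by split=> //; rewrite -E in tp2; exact: torsion_unique tp1 tp2 FF.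
Qed.

Lemma tilting_datum_unique D1 D2 T1 F1 T2 F2 :
  tilting_datum D1 T1 F1 -> tilting_datum D2 T2 F2 -> same_subcat T1 T2 ->
  D1 = D2 /\ same_subcat F1 F2.
Proof.
move=> H1 H2 TT; have [_ tp1 _] := H1; have [_ tp2 _] := H2.
have E : D1 = D2.
  apply: (@support_unique _ _ T1 (tilting_datum_sincere H1)).
  - by move=> i /(tilting_datum_sincere H2)[Y [/TT TY]]; exists Y.
  - by move=> Y /(torsionP _ tp1)[].
  - by move=> Y /TT/(torsionP _ tp2)[].
by split=> //; rewrite -E in tp2; exact: torsionfree_unique tp1 tp2 TT.
Qed.

(** The uniserial module of length n ending at a vertex of D2 lies in the ray and meets every
    vertex, whereas F1 vanishes on D1. *)
Lemma data_disjoint D1 D2 T1 F1 T2 F2 : cotilting_datum D1 T1 F1 -> tilting_datum D2 T2 F2 ->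
  ~ same_subcat F1 (oplus F2 (Ray D2)).
Proof.
move=> [/set0Pn[d1 d1D] tp1 _] [/set0Pn[d2 d2D] tp2 _] FF.
pose M := uniserial K (ordS d2) n.
have RM : Ray D2 M.
  apply: uniserial_Ray => k kn; suff -> : sh k (ordS d2) = d2 by [].
  by apply/eqP; rewrite -shSr kn sh_eq.
have FM : F1 M.
  apply/FF; exists (zeromod K n), M; split=> //.
    by apply: (torsionfree_zero tp2) => [|z]; [apply: Omega_zero => z|]; apply/rowP; case.
  exact: iso_trans (dsum_zero_iso M) (dsumC_iso _ _).
have [CM _] := proj1 (torsionfreeP _ tp1) FM.
have [k kn kd] := sh_to (ordS d2) d1.
have /eqP := Omega_idem0 (uni_gen K (ordS d2) (Ordinal kn)) CM d1D.
apply/negP/eqP => /ffunP/(_ (Ordinal kn)) /eqP.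
by rewrite [X in X == _]uni_idemE kd eqxx !ffunE eqxx oner_eq0.
Qed.

Lemma torsion_pairs_classified T F : (0 < n)%N -> torsion_pair (@Ecat K n) T F ->
  (exists D T' F', [/\ cotilting_datum D T' F', same_subcat T (oplus (Coray D) T') & same_subcat F F']) \/
  (exists D T' F', [/\ tilting_datum D T' F', same_subcat T T' & same_subcat F (oplus F' (Ray D))]).
Proof.
move=> n0 tp; have [D [sF FO]] := support_ex F; have [E [sT TO]] := support_ex T.
have OE (d : 'I_n) (S : {set 'I_n}) : d \in S -> forall M, Omega_mod (~: S) M -> Ecat M.
  by move=> dS M; apply: (@Omega_Ecat _ _ _ d); rewrite inE negbK.
have [D0|D0] := eqVneq D set0; last first.
  left; have [d dD] := set0Pn _ D0; pose C' := @Omega_mod K n (~: D).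
  have tp' : torsion_pair C' (fun M => T M /\ C' M) F.
    apply: torsion_pair_same (torsion_pair_restrict tp (OE d D dD) (@Omega_sub _ _ _) (@Omega_quot _ _ _)) => //.
    by move=> M; split=> [[]|FM]; [|split=> //; exact: FO].
  exists D, (fun M => T M /\ C' M), F; split=> //.
    by split=> //; exact: (cotilting_ex dD tp' sF).
  (* Both torsion pairs on E_n have the same torsion-free class, so their torsion classes agree. *)
  exact: (torsion_unique tp (coray_torsion_pair D0 tp' sF) (@same_refl _ _ _)).
have [E0|E0] := eqVneq E set0.
  by case: (not_both_sincere n0 tp); [rewrite -E0|rewrite -D0].
right; have [d dE] := set0Pn _ E0; pose C' := @Omega_mod K n (~: E).
have tp' : torsion_pair C' T (fun M => F M /\ C' M).
  apply: torsion_pair_same (torsion_pair_restrict tp (OE d E dE) (@Omega_sub _ _ _) (@Omega_quot _ _ _)) => //.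
  by move=> M; split=> [[]|TM]; [|split=> //; exact: TO].
exists E, T, (fun M => F M /\ C' M); split=> //.
  by split=> //; exact: (tilting_ex dE tp' sT).
exact: (torsionfree_unique tp (ray_torsion_pair E0 tp' sT) (@same_refl _ _ _)).
Qed.

End Classification.

Theorem theorem4p14 (K : fieldType) (n : nat) (n_gt0 : (0 < n)%N) :
  (* the pairs (1) and (2) are torsion pairs on E_n *)
  (forall (Delta : {set 'I_n}) (T' F' : subcat K n),
     cotilting_datum Delta T' F' ->
     torsion_pair (@Ecat K n) (oplus (Coray Delta) T') F') /\
  (forall (Delta : {set 'I_n}) (T' F' : subcat K n),
     tilting_datum Delta T' F' ->
     torsion_pair (@Ecat K n) T' (oplus F' (Ray Delta))) /\
  (* they are mutually different *)
  (forall (Delta1 Delta2 : {set 'I_n}) (T1 F1 T2 F2 : subcat K n),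
     cotilting_datum Delta1 T1 F1 -> cotilting_datum Delta2 T2 F2 ->
     same_subcat (oplus (Coray Delta1) T1) (oplus (Coray Delta2) T2) ->
     same_subcat F1 F2 ->
     Delta1 = Delta2 /\ same_subcat T1 T2) /\
  (forall (Delta1 Delta2 : {set 'I_n}) (T1 F1 T2 F2 : subcat K n),
     tilting_datum Delta1 T1 F1 -> tilting_datum Delta2 T2 F2 ->
     same_subcat T1 T2 ->
     same_subcat (oplus F1 (Ray Delta1)) (oplus F2 (Ray Delta2)) ->
     Delta1 = Delta2 /\ same_subcat F1 F2) /\
  (forall (Delta1 Delta2 : {set 'I_n}) (T1 F1 T2 F2 : subcat K n),
     cotilting_datum Delta1 T1 F1 -> tilting_datum Delta2 T2 F2 ->
     ~ (same_subcat (oplus (Coray Delta1) T1) T2 /\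
        same_subcat F1 (oplus F2 (Ray Delta2)))) /\
  (* every torsion pair on E_n is one of them *)
  (forall T F : subcat K n, torsion_pair (@Ecat K n) T F ->
     (exists (Delta : {set 'I_n}) (T' F' : subcat K n),
        [/\ cotilting_datum Delta T' F',
            same_subcat T (oplus (Coray Delta) T') & same_subcat F F']) \/
     (exists (Delta : {set 'I_n}) (T' F' : subcat K n),
        [/\ tilting_datum Delta T' F',
            same_subcat T T' & same_subcat F (oplus F' (Ray Delta))])).
Proof.
split; first exact: cotilting_datum_tp.
split; first exact: tilting_datum_tp.
split; first by move=> D1 D2 T1 F1 T2 F2 H1 H2 _; exact: cotilting_datum_unique.
split; first by move=> D1 D2 T1 F1 T2 F2 H1 H2 TT _; exact: tilting_datum_unique H1 H2 TT.
split; first by move=> D1 D2 T1 F1 T2 F2 H1 H2 [_]; exact: data_disjoint H1 H2.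
by move=> T F; exact: torsion_pairs_classified.
Qed.
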